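(* Let $P\in\mathbb{C}[z]$ be a polynomial with $|P(0)|=1$, $\|P\|_0<e$, and $Z(P)\geq 1$. Then \[ \frac{\log^2 M(P)}{Z(P)} \leq \log\|P\|_0\left(1+\sum_{k=1}^\infty\left(\sum_{\ell=1}^{k+1}\frac{1}{\ell(k+2-\ell)}-\frac{1}{k+2}\right)\left(\log\|P\|_0\right)^{k/2}\right), \] where $\log^2 M(P)=(\log M(P))^2$.
   Context: For a nonzero polynomial $P\in\mathbb{C}[z]$, the (logarithmic) Mahler measure is $\log M(P)=\frac{1}{2\pi}\int_0^{2\pi}\log|P(e^{it})|\,dt$, and the areal Mahler measure is defined by $\log\|P\|_0=\frac{1}{\pi}\iint_{D}\log|P(z)|\,dA$, where $D$ is the open unit disk in $\mathbb{C}$ and $dA$ is area measure. $Z(P)$ denotes the number of roots of $P$ (counted with multiplicity) lying in the open unit disk. *)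

(* Defs.v *)
From mathcomp Require Import all_boot all_order all_algebra.
From mathcomp Require Import complex.
From mathcomp Require Import all_classical all_reals all_analysis.
Import Order.TTheory GRing.Theory Num.Theory.
Import numFieldNormedType.Exports.

Set Implicit Arguments.
Unset Strict Implicit.
Unset Printing Implicit Defensive.

Local Open Scope classical_set_scope.
Local Open Scope ring_scope.
Local Open Scope complex_scope.

(* The norm `|z| of z : R[i] is itself an element of R[i]; cabs is the same
   modulus, as an element of R. *)
Definition cabs (R : realType) (z : R[i]) : R := ComplexField.Normc.normc z.

(* In both integrals below the integrand takes the value ln 0 = 0, instead of
   -oo, at the roots of P; for P != 0 this only affects a null set. *)
Definition log_mahler (R : realType) (P : {poly R[i]}) : R :=
  (2 * pi)^-1 *
  \int[lebesgue_measure]_(t in `[0, 2 * pi]) ln (cabs P.[cos t +i* sin t]).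

(* The open unit disk, C being identified with R * R, so that the area measure
   is the product Lebesgue measure. *)
Definition unit_disk (R : realType) : set (R * R) :=
  [set xy | cabs (xy.1 +i* xy.2) < 1].
Arguments unit_disk : clear implicits.

Definition log_areal_mahler (R : realType) (P : {poly R[i]}) : R :=
  pi^-1 *
  \int[(lebesgue_measure \x lebesgue_measure)%E]_(xy in unit_disk R)
    ln (cabs P.[xy.1 +i* xy.2]).

Definition mahler (R : realType) (P : {poly R[i]}) : R := expR (log_mahler P).

Definition areal_mahler (R : realType) (P : {poly R[i]}) : R :=
  expR (log_areal_mahler P).

(* For P != 0, sval (closed_field_poly_normal P) lists the roots of P with
   multiplicity. *)
Definition nroots_disk (R : realType) (P : {poly R[i]}) : nat :=
  count (fun z => cabs z < 1) (sval (closed_field_poly_normal P)).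

Definition areal_coef (R : realType) (k : nat) : R :=
  \sum_(1 <= l < k.+2) (l%:R * (k.+2 - l)%:R)^-1 - k.+2%:R^-1.

(* Main.v *)
Require Import Defs.
From mathcomp Require Import all_boot all_order all_algebra.
From mathcomp Require Import complex.
From mathcomp Require Import all_classical all_reals all_analysis.
From mathcomp Require Import measurable_realfun.
From mathcomp Require Import ring lra.
Import Order.TTheory GRing.Theory Num.Theory.
Import numFieldNormedType.Exports.

Set Implicit Arguments.
Unset Strict Implicit.
Unset Printing Implicit Defensive.

Local Open Scope classical_set_scope.
Local Open Scope ring_scope.
Local Open Scope complex_scope.

(** Let [a] run over the roots of [P] in the unit disk, and put
    [u = - ln |a|] and [f u = u - (1 - expR (- 2u)) / 2]. As [|P(0)| = 1],
    Jensen's formula gives [ln (mahler P) = sum u] and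
    [ln (areal_mahler P) = sum (f u) =: L]. By Cauchy-Schwarz the left-hand
    side of the theorem is at most [sum (u ^ 2)]. The right-hand side is
    [L * h L] with [h] nondecreasing, hence at least [sum (f u * h (f u))], and
    it suffices that [u ^ 2 <= f u * h (f u)] for each root. Put
    [f u = y ^ 2] and [v = - ln (1 - y)]; summing the series gives
    [f u * h (f u) = v ^ 2 - (f v - f u)]. Now
    [f v >= (1 - expR (- v)) ^ 2 = f u] forces [u <= v], and [t ^ 2 - f t] is
    nondecreasing in [t].

    The mean [K b] of [ln |1 - b z|] over the unit circle vanishes for [|b| < 1]
    because [|1 - b z| |1 + b z| = |1 - b^2 z^2|] gives [K b = K (b^2) / 2],
    which can be iterated; [|b| = 1] follows by monotone convergence. The area
    integral of [ln |z - a|] is reduced to circle means by averaging over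
    rotations, under which plane Lebesgue measure is invariant since rotations
    are products of shears. *)

(** * The one-variable inequality *)

Section Monotonicity.
Context {R : realType}.
Implicit Types (f df : R -> R) (a b u v y : R).

Lemma is_derive_continuous f df a b :
  (forall x, a <= x <= b -> is_derive x 1 f (df x)) ->
  {within `[a, b], continuous f}.
Proof.
move=> fd; apply: continuous_in_subspaceT => x; rewrite inE/= in_itv/= => xab.
by have [fx _] := fd x xab; apply/differentiable_continuous/derivable1_diffP.
Qed.

Lemma is_derive_mean_value f df a b : a < b ->
  (forall x, a <= x <= b -> is_derive x 1 f (df x)) ->
  exists2 c, a < c < b & f b - f a = df c * (b - a).
Proof.
move=> ab fd; have [|c cab E] := @MVT R f df a b ab _ (is_derive_continuous fd).
  by move=> x; rewrite in_itv/= => /andP[ax xb]; apply: fd; rewrite !ltW.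
by exists c => //; move: cab; rewrite in_itv.
Qed.

Lemma is_derive_ge0_le f df a b : a <= b ->
  (forall x, a <= x <= b -> is_derive x 1 f (df x)) ->
  (forall x, a <= x <= b -> 0 <= df x) -> f a <= f b.
Proof.
rewrite le_eqVlt => /predU1P[->//|ab] fd df0.
have [c /andP[ac cb] fE] := is_derive_mean_value ab fd.
rewrite -subr_ge0 fE mulr_ge0 ?subr_ge0 ?(ltW ab)//.
by apply: df0; rewrite !ltW.
Qed.

(* The contribution to the areal measure of a root of modulus [expR (- u)]
   in the unit disk. *)
Definition areal_part u : R := u - (1 - expR (- (2 * u))) / 2.

Lemma is_derive_areal_part u :
  is_derive u 1 areal_part (1 - expR (- (2 * u))).
Proof.
rewrite /areal_part; apply: is_derive_eq.
by rewrite /GRing.scale/=; field.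
Qed.

(** The difference of the two sides is [g u], where [g] vanishes at 0 and its derivative is a
    square. *)
Lemma areal_part_ge u : 0 <= u -> (1 - expR (- u)) ^+ 2 <= areal_part u.
Proof.
move=> u0; pose g (t : R) : R := t - 3 / 2 + 2 * expR (- t) - expR (- (2 * t)) / 2.
have gd (t : R) : is_derive t 1 g ((1 - expR (- t)) ^+ 2).
  rewrite /g; apply: is_derive_eq.
  have -> : - (2 * t) = - t + - t by ring.
  by rewrite expRD /GRing.scale/=; field.
have : g 0 <= g u.
  by apply: (is_derive_ge0_le u0 (fun t _ => gd t)) => t _; exact: sqr_ge0.
rewrite /g /areal_part mulr0 oppr0 expR0.
have -> : - (2 * u) = - u + - u by ring.
by rewrite expRD; nra.
Qed.

Lemma areal_part_ge0 u : 0 <= u -> 0 <= areal_part u.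
Proof. by move=> u0; apply: le_trans (areal_part_ge u0); exact: sqr_ge0. Qed.

(** Strict even for [u = 0], since the mean value point [c] exceeds [u] and so
    [1 - expR (- (2 * c)) > 0]. *)
Lemma areal_part_lt u v : 0 <= u -> u < v -> areal_part u < areal_part v.
Proof.
move=> u0 uv; have [|c /andP[uc _] E] :=
  @is_derive_mean_value areal_part (fun x => 1 - expR (- (2 * x))) u v uv.
  by move=> x _; exact: is_derive_areal_part.
rewrite -subr_gt0 E mulr_gt0 ?subr_gt0// expR_lt1 oppr_lt0 mulr_gt0//.
exact: le_lt_trans uc.
Qed.

(** The derivative [2 * t - 1 + expR (- (2 * t))] is nonnegative by [1 + x <= expR x]. *)
Lemma sqr_sub_areal_part_le u v : 0 <= u -> u <= v ->
  u ^+ 2 - areal_part u <= v ^+ 2 - areal_part v.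
Proof.
move=> u0 uv.
apply: (@is_derive_ge0_le (fun t => t ^+ 2 - areal_part t)
  (fun t => 2 * t - (1 - expR (- (2 * t)))) _ _ uv) => t.
- move=> _; have ? := is_derive_areal_part t.
  apply: is_derive_eq; rewrite /GRing.scale/=; ring.
- move=> _; have := expR_ge1Dx (- (2 * t)); lra.
Qed.

(* With [v = - ln (1 - y)] the right-hand side is
   [v ^+ 2 - (areal_part v - y ^+ 2)]. *)
Lemma sqr_le_areal_part u y : 0 <= u -> 0 <= y < 1 -> y ^+ 2 = areal_part u ->
  u ^+ 2 <= ln (1 - y) ^+ 2 + ln (1 - y) + y + y ^+ 2 / 2.
Proof.
move=> u0 /andP[y0 y1] yE; set v := - ln (1 - y).
have y10 : 0 < 1 - y by rewrite subr_gt0.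
have v0 : 0 <= v by rewrite oppr_ge0 ln_le0// lerBlDr lerDl.
have ev : expR (- v) = 1 - y by rewrite opprK lnK.
have vE : areal_part v = v - (1 - (1 - y) ^+ 2) / 2.
  rewrite /areal_part; have -> : - (2 * v) = - v + - v by ring.
  by rewrite expRD ev.
(* If [v < u], then [areal_part v < y ^+ 2], against [areal_part_ge], since [1 - expR (- v) = y]. *)
have uv : u <= v.
  rewrite leNgt; apply/negP => /(areal_part_lt v0).
  by rewrite -yE; have := areal_part_ge v0; rewrite ev; nra.
have := sqr_sub_areal_part_le u0 uv; rewrite vE -yE /v; nra.
Qed.

End Monotonicity.

(** * The power series *)

Section Series.
Context {R : realType}.
Implicit Types (y : R) (n k : nat).

(** Partial sum of the Mercator series of [- ln (1 - y)]. *)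
Definition mercator n y : R := \sum_(i < n) y ^+ i.+1 / i.+1%:R.

(** The differentiated series is geometric, so the remainder has derivative
    [1 / (1 - y) - (1 - y ^+ n) / (1 - y)]. *)
Lemma is_derive_mercator n y : y < 1 ->
  is_derive y 1 (fun t => - ln (1 - t) - mercator n t) (y ^+ n / (1 - y)).
Proof.
move=> y1; have y10 : 0 < 1 - y by rewrite subr_gt0.
have dm m : is_derive y 1 (mercator m) (\sum_(i < m) y ^+ i).
  elim: m => [|m IH].
    rewrite big_ord0; have -> : mercator 0 = cst 0.
      by apply/funext => t; rewrite /mercator big_ord0.
    exact: is_derive_cst.
  rewrite big_ord_recr/=; have -> : mercator m.+1 =
      mercator m + m.+1%:R^-1 *: (fun t : R => t ^+ m.+1).
    apply/funext => t; rewrite /mercator big_ord_recr/= [_ / _]mulrC//.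
  apply: is_deriveD.
  have dX : is_derive y 1 (fun t : R => t ^+ m.+1) (m.+1%:R * y ^+ m).
    have -> : (fun t : R => t ^+ m.+1) = (id : R -> R) ^+ m.+1.
      by apply/funext => t; rewrite fctE.
    by apply: is_derive_eq; rewrite /GRing.scale/= mulr1.
  apply: is_derive_eq (is_deriveZ _ dX) _.
  by rewrite /GRing.scale/= mulKf// pnatr_eq0.
have ? := dm n.
have dl : is_derive y 1 (fun t : R => ln (1 - t)) (- (1 - y)^-1).
  have d1 : is_derive y 1 (fun t : R => 1 - t) (- 1).
    have -> : (fun t : R => 1 - t) = cst 1 - id by apply/funext.
    by apply: is_derive_eq; rewrite sub0r.
  by apply: is_derive_eq (@is_derive1_comp R _ (fun t => 1 - t) y _ _
    (is_derive1_ln y10) d1) _; rewrite mulrN1.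
apply: is_derive_eq.
have := subrX1 y n; rewrite -(opprB 1 y) => E.
apply: (mulIf (lt0r_neq0 y10)); rewrite mulrBl opprK mulVf ?lt0r_neq0//.
by rewrite divfK ?lt0r_neq0//; lra.
Qed.

Lemma mercator_ge0 n y : 0 <= y -> 0 <= mercator n y.
Proof. by move=> y0; apply: sumr_ge0 => i _; rewrite divr_ge0// exprn_ge0. Qed.

Lemma mercator_le n y : 0 <= y < 1 -> mercator n y <= - ln (1 - y).
Proof.
move=> /andP[y0 y1]; rewrite -subr_ge0.
have -> : 0 = - ln (1 - 0) - mercator n 0 :> R.
  rewrite subr0 ln1 oppr0 /mercator big1 ?subr0// => i _.
  by rewrite expr0n mul0r.
apply: (@is_derive_ge0_le R (fun t => - ln (1 - t) - mercator n t)
  (fun t => t ^+ n / (1 - t)) _ _ y0) => t /andP[t0 ty].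
  exact/is_derive_mercator/(le_lt_trans ty).
by rewrite divr_ge0 ?exprn_ge0// subr_ge0 ltW// (le_lt_trans ty).
Qed.

(** On [[0, y]] the derivative of the remainder is at most its value [y ^+ n / (1 - y)] at [y];
    hence the remainder is at most [y] times that value, and [y < 1]. *)
Lemma mercator_ge n y : 0 <= y < 1 ->
  - ln (1 - y) - y ^+ n / (1 - y) <= mercator n y.
Proof.
move=> /andP[y0 y1]; have y10 : 0 < 1 - y by rewrite subr_gt0.
have : y ^+ n / (1 - y) * 0 - (- ln (1 - 0) - mercator n 0) <=
    y ^+ n / (1 - y) * y - (- ln (1 - y) - mercator n y) :> R.
  apply: (@is_derive_ge0_le R
    (fun t => y ^+ n / (1 - y) * t - (- ln (1 - t) - mercator n t))
    (fun t => y ^+ n / (1 - y) - t ^+ n / (1 - t)) _ _ y0) => t /andP[t0 ty].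
    have ? := is_derive_mercator n (le_lt_trans ty y1).
    by apply: is_derive_eq; rewrite /GRing.scale/= mulr1.
  rewrite subr_ge0 ler_pM ?exprn_ge0 ?invr_ge0 ?subr_ge0//.
  - by rewrite ltW// (le_lt_trans ty).
  - by rewrite lerXn2r ?nnegrE.
  - by rewrite lef_pV2 ?posrE ?subr_gt0 ?lerB// (le_lt_trans ty).
have -> : mercator n (0 : R) = 0.
  by rewrite /mercator big1 // => i _; rewrite expr0n mul0r.
rewrite !subr0 ln1 mulr0 oppr0 subr0 => h.
have : y ^+ n / (1 - y) * y <= y ^+ n / (1 - y).
  by rewrite ler_piMr ?divr_ge0 ?exprn_ge0 ?(ltW y10) ?(ltW y1).
lra.
Qed.

Lemma mercator_cvg y : 0 <= y < 1 -> mercator n y @[n --> \oo] --> - ln (1 - y).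
Proof.
move=> y01; have /andP[y0 y1] := y01.
apply: (@squeeze_cvgr _ _ _ _ (fun n => - ln (1 - y) - y ^+ n / (1 - y))
  (fun=> - ln (1 - y))).
- by near=> n; rewrite mercator_ge// mercator_le.
- rewrite -[X in _ --> X]subr0 -(mul0r (1 - y)^-1).
  apply: cvgB; first exact: cvg_cst.
  by apply: cvgMl; apply: cvg_expr; rewrite ger0_norm.
- exact: cvg_cst.
Unshelve. all: by end_near. Qed.

(** Coefficient of [y ^+ k.+2] in the square of the Mercator series. *)
Definition convol_coef k : R := \sum_(1 <= l < k.+2) (l%:R * (k.+2 - l)%:R)^-1.

Lemma areal_coefE k : areal_coef R k = convol_coef k - k.+2%:R^-1.
Proof. by []. Qed.

(** The term [l = 1] of the sum is [1 / (k + 1)], which already exceeds the subtracted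
    [1 / (k + 2)]. *)
Lemma areal_coef_ge0 k : 0 <= areal_coef R k.
Proof.
rewrite areal_coefE subr_ge0 /convol_coef big_ltn// subn1/= mul1r.
rewrite ler_wpDr ?lef_pV2 ?posrE ?ler_nat//.
by apply: sumr_ge0 => i _; rewrite invr_ge0.
Qed.

Lemma convol_coef_ge0 k : 0 <= convol_coef k.
Proof. by apply: sumr_ge0 => i _; rewrite invr_ge0. Qed.

(** The powers of [y] are absorbed into the coefficients and the polynomial is evaluated at 1.
    Coefficient [i] carries the term of degree [i + 1], so coefficient [k] of the square has degree
    [k + 2] in [y]. *)
Let mpoly n y : {poly R} := \poly_(i < n) (y ^+ i.+1 / i.+1%:R).

Let mpolyE n y : (mpoly n y).[1] = mercator n y.
Proof.
by rewrite horner_poly; apply: eq_bigr => i _; rewrite expr1n mulr1.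
Qed.

Let convol_coefE k y : convol_coef k * y ^+ k.+2 =
  \sum_(i < k.+1) (y ^+ i.+1 / i.+1%:R) * (y ^+ (k - i).+1 / (k - i).+1%:R).
Proof.
rewrite /convol_coef mulr_suml big_add1/= big_mkord; apply: eq_bigr => i _.
have ik : (i <= k)%N by rewrite -ltnS.
have -> : (k.+2 - i.+1 = (k - i).+1)%N by rewrite subSS subSn.
have -> : y ^+ k.+2 = y ^+ i.+1 * y ^+ (k - i).+1.
  by rewrite -exprD addSn addnS subnKC.
by rewrite invfM; ring.
Qed.

(** The first [n] coefficients of the squared polynomial are full convolutions, unaffected by the
    truncation; the remaining ones are nonnegative. *)
Lemma sum_convol_coef_le n y : 0 <= y ->
  \sum_(k < n) convol_coef k * y ^+ k.+2 <= mercator n y ^+ 2.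
Proof.
move=> y0; rewrite -mpolyE expr2 -hornerM.
rewrite (@horner_coef_wide _ (n + n)); last first.
  rewrite (leq_trans (size_polyMleq _ _))// (leq_trans (leq_pred _))//.
  by rewrite leq_add// size_poly.
rewrite big_split_ord/= ler_wpDr//.
  apply: sumr_ge0 => i _; rewrite expr1n mulr1 coefM sumr_ge0// => j _.
  by rewrite mulr_ge0// coef_poly; case: ifP => // _; rewrite divr_ge0 ?exprn_ge0.
apply: ler_sum => i _; rewrite expr1n mulr1 coefM convol_coefE.
apply: ler_sum => j _; rewrite !coef_poly.
have jn : (j < n)%N by rewrite (leq_ltn_trans _ (ltn_ord i))// -ltnS.
by rewrite jn (leq_ltn_trans (leq_subr _ _) (ltn_ord i)).
Qed.

(** The square has at most [n + n] coefficients, each obtained from the full convolution by dropping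
    nonnegative terms. *)
Lemma sum_convol_coef_ge n y : 0 <= y ->
  mercator n y ^+ 2 <= \sum_(k < n + n) convol_coef k * y ^+ k.+2.
Proof.
move=> y0; rewrite -mpolyE expr2 -hornerM.
rewrite (@horner_coef_wide _ (n + n)); last first.
  rewrite (leq_trans (size_polyMleq _ _))// (leq_trans (leq_pred _))//.
  by rewrite leq_add// size_poly.
apply: ler_sum => i _; rewrite expr1n mulr1 coefM convol_coefE.
apply: ler_sum => j _; rewrite !coef_poly.
by case: ifP => _; case: ifP => _; rewrite ?mul0r ?mulr0//;
  rewrite mulr_ge0// divr_ge0 ?exprn_ge0.
Qed.

(** The series of the theorem in the variable [y = Num.sqrt L], which turns half-integral powers of
    [L] into integral powers of [y]. *)
Definition areal_sum y n : R := \sum_(1 <= k < n) areal_coef R k * y ^+ k.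

(** The leading 1 supplies the convolution term [k = 0]; the subtracted fractions form a Mercator
    sum without its first two terms [y + y ^+ 2 / 2], which are added back. *)
Lemma areal_sumS y n : y ^+ 2 * (1 + areal_sum y n.+1) =
  \sum_(k < n.+1) convol_coef k * y ^+ k.+2 - mercator n.+2 y + y + y ^+ 2 / 2.
Proof.
rewrite /areal_sum big_add1/= big_mkord big_ord_recl/= /mercator !big_ord_recl/=.
have -> : convol_coef 0 = 1.
  by rewrite /convol_coef big_nat1 subSS subn0 mulr1 invr1.
under [X in _ * (1 + X)]eq_bigr do rewrite areal_coefE mulrBl.
rewrite sumrB mulrDr mulr1 mulrBr !mulr_sumr.
under [X in _ + (X - _)]eq_bigr do rewrite mulrCA -exprD !add2n.
under [X in _ + (_ - X)]eq_bigr do rewrite mulrCA -exprD !add2n mulrC.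
rewrite mul1r expr1 divr1.
rewrite /bump/=; under [in RHS]eq_bigr do rewrite add1n.
under [X in _ = _ - (_ + (_ + X)) + _ + _]eq_bigr do rewrite !add1n.
rewrite addn0; lra.
Qed.

Lemma areal_sum_nd y : 0 <= y -> {homo areal_sum y : m n / (m <= n)%N >-> m <= n}.
Proof.
move=> y0 m n mn; rewrite /areal_sum; case: (leqP 1 m) => [m1|].
  rewrite (@big_cat_nat _ _ _ m 1 n)//= ler_wpDr// sumr_ge0// => i _.
  by rewrite mulr_ge0 ?areal_coef_ge0 ?exprn_ge0.
rewrite ltnS leqn0 => /eqP->; rewrite big_geq// sumr_ge0// => i _.
by rewrite mulr_ge0 ?areal_coef_ge0 ?exprn_ge0.
Qed.

Lemma areal_sum_cvg y : 0 <= y < 1 -> cvgn (areal_sum y).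
Proof.
move=> y01; have /andP[y0 y1] := y01.
(* The upper bound used for monotone convergence divides by [y ^+ 2], so [y = 0] is treated
   apart. *)
have [->|yn0] := eqVneq y 0.
  rewrite (_ : areal_sum 0 = cst 0); first exact: is_cvg_cst.
  apply/funext => n; rewrite /areal_sum big_nat_cond big1//= => i /andP[/andP[i1 _] _].
  by rewrite expr0n eqn0Ngt i1/= mulr0.
apply: nondecreasing_is_cvgn; first exact: areal_sum_nd.
exists (ln (1 - y) ^+ 2 / y ^+ 2) => _ [n _ <-].
rewrite ler_pdivlMr ?exprn_gt0 ?lt_neqAle 1?eq_sym ?yn0//.
apply: (@le_trans _ _ (mercator n y ^+ 2)); last first.
  have := mercator_le n y01; have := mercator_ge0 n y0; nra.
apply: le_trans (sum_convol_coef_le _ y0).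
case: n => [|n]; first by rewrite /areal_sum big_geq// mul0r big_ord0.
rewrite /areal_sum big_add1/= big_mkord big_ord_recl/= ler_wpDl//.
  by rewrite mulr_ge0 ?convol_coef_ge0 ?exprn_ge0.
rewrite mulr_suml ler_sum// => i _; rewrite -mulrA -exprD addn2.
by rewrite ler_wpM2r ?exprn_ge0// areal_coefE gerBl invr_ge0.
Qed.

(** The left-hand side is the limit of the same expression with [ln (1 - y) ^+ 2] replaced by
    [mercator n y ^+ 2], and each such expression is bounded by a partial sum on the right. *)
Lemma areal_sum_lim_ge y : 0 <= y < 1 ->
  ln (1 - y) ^+ 2 + ln (1 - y) + y + y ^+ 2 / 2 <=
  y ^+ 2 * (1 + limn (areal_sum y)).
Proof.
move=> y01; have /andP[y0 y1] := y01.
have cvg2 : mercator n y ^+ 2 + ln (1 - y) + y + y ^+ 2 / 2 @[n --> \oo] -->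
    ln (1 - y) ^+ 2 + ln (1 - y) + y + y ^+ 2 / 2.
  apply: cvgD; last exact: cvg_cst.
  apply: cvgD; last exact: cvg_cst.
  apply: cvgD; last exact: cvg_cst.
  rewrite -(sqrrN (ln _)) !expr2.
  have := mercator_cvg y01 => h.
  under eq_fun do rewrite expr2.
  exact: cvgM.
rewrite -(cvg_lim _ cvg2)//; apply: limr_le; first exact: cvgP cvg2.
near=> n.
have n0 : (0 < n)%N by near: n; exact: nbhs_infty_gt.
(* Length [n + n] is what [sum_convol_coef_ge] requires to cover the square of [mercator n y]. *)
apply: (@le_trans _ _ (y ^+ 2 * (1 + areal_sum y (n + n)))); last first.
  rewrite ler_wpM2l ?exprn_ge0// lerD2l.
  exact: (nondecreasing_cvgn_le (areal_sum_nd y0) (areal_sum_cvg y01)).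
have nn : (0 < n + n)%N by rewrite addn_gt0 n0.
rewrite -(prednK nn) areal_sumS (prednK nn).
have := sum_convol_coef_ge n y0.
have := mercator_le (n + n).+1 y01; lra.
Unshelve. all: by end_near. Qed.

Lemma areal_sum_lim_le y z : 0 <= y -> y <= z -> z < 1 ->
  limn (areal_sum y) <= limn (areal_sum z).
Proof.
move=> y0 yz z1; apply: ler_lim.
- by apply: areal_sum_cvg; rewrite y0 (le_lt_trans yz).
- by apply: areal_sum_cvg; rewrite z1 (le_trans y0).
near=> n; apply: ler_sum => i _; rewrite ler_wpM2l ?areal_coef_ge0//.
by rewrite lerXn2r ?nnegrE// (le_trans y0).
Unshelve. all: by end_near. Qed.

End Series.
(** * Logarithmic means over the circle *)

Section CircleMean.
Context {R : realType}.
Implicit Types (f g F : R -> R) (a b p q s t x : R).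
Local Notation mu := (@lebesgue_measure R).

Lemma continuous_itv_integrable f a b : continuous f ->
  mu.-integrable `[a, b] (EFin \o f).
Proof.
move=> cf; apply: continuous_compact_integrable; first exact: segment_compact.
exact: continuous_subspaceT.
Qed.

Lemma continuous_antiderivative f : continuous f ->
  exists F : R -> R, (forall x, 0 <= x -> is_derive x 1 F (f x)) /\
    (forall a, 0 < a -> \int[mu]_(x in `[0, a]) f x = F a - F 0).
Proof.
move=> cf.
(* Integrating from -1 makes 0 an interior point, so that [F] has a two-sided derivative there. *)
pose F := fun x : R => \int[mu]_(t in [set` Interval (BLeft (- 1)) (BRight x)]) f t.
have Fd x : 0 <= x -> is_derive x 1 F (f x).
  move=> x0; have [] := @continuous_FTC1 R f (BLeft (- 1)) x (x + 1).
  - by rewrite ltrDl.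
  - exact: continuous_itv_integrable.
  - by rewrite lte_fin (lt_le_trans _ x0)// ltrN10.
  - exact: cf.
  by move=> Fd FE; rewrite -FE derive1E; exact: derivableP.
exists F; split => // a a0.
rewrite /Rintegral (@continuous_FTC2 R f F 0 a a0)//.
- exact: continuous_subspaceT.
- have Fc x : 0 <= x -> {for x, continuous F}.
    by case/Fd => ? _; apply/differentiable_continuous/derivable1_diffP.
  split.
  + by move=> x; rewrite in_itv/= => /andP[/ltW/Fd[]].
  + exact/cvg_at_right_filter/Fc.
  + exact/cvg_at_left_filter/Fc/ltW.
- by move=> x; rewrite in_itv/= => /andP[/ltW/Fd[_ FE] _]; rewrite derive1E.
Qed.

(** With antiderivatives [F] and [G], the function [F t + F (t + pi) - G (2 * t) / 2] is constant on
    [[0, pi]]; in comparing its end values, [F pi] cancels. *)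
Lemma Rintegral_doubling f g : continuous f -> continuous g ->
  (forall t, f t + f (t + pi) = g (2 * t)) ->
  \int[mu]_(t in `[0, 2 * pi]) g t = 2 * \int[mu]_(t in `[0, 2 * pi]) f t.
Proof.
move=> /continuous_antiderivative[F [dF ->]]; last by rewrite mulr_gt0 ?pi_gt0.
move=> /continuous_antiderivative[G [dG ->]]; last by rewrite mulr_gt0 ?pi_gt0.
move=> fg.
have dH t : 0 <= t <= pi ->
    is_derive t 1 (fun t => F t + F (t + pi) - G (2 * t) / 2) 0.
  move=> /andP[t0 _].
  have tpi : 0 <= t + pi by rewrite addr_ge0 ?pi_ge0.
  have t2 : 0 <= 2 * t by rewrite mulr_ge0.
  have ? := dF _ t0; have ? := dF _ tpi; have ? := dG _ t2.
  have d1 : is_derive t 1 (fun t => F (t + pi)) (f (t + pi)).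
    have d : is_derive t 1 (fun t : R => t + pi) 1.
      by apply: is_derive_eq; rewrite addr0.
    by apply: is_derive_eq
      (@is_derive1_comp R F (fun t => t + pi) t _ _ (dF _ tpi) d) _; rewrite mulr1.
  have d2 : is_derive t 1 (fun t => G (2 * t)) (2 * g (2 * t)).
    have d : is_derive t 1 (fun t : R => 2 * t) 2.
      by apply: is_derive_eq; rewrite /GRing.scale/= mulr1.
    by apply: is_derive_eq
      (@is_derive1_comp R G (fun t => 2 * t) t _ _ (dG _ t2) d) _; rewrite mulrC.
  by apply: is_derive_eq; rewrite /GRing.scale/= -fg; field.
have [c _] := is_derive_mean_value (pi_gt0 R) dH.
rewrite mul0r add0r mulr0 (_ : pi + pi = 2 * pi); [lra|ring].
Qed.

(* [`|1 - b * e^(it)| ^+ 2] for [b = p + iq]. *)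
Definition circ p q t : R := 1 + p ^+ 2 + q ^+ 2 - 2 * (p * cos t - q * sin t).

(** The squared form of [|1 - b^2 z^2| = |1 - b z| |1 + b z|]: the first two arguments on the left
    are the parts of [b^2], and [t + pi] replaces [z] by [- z]. *)
Lemma circ_sqr p q t :
  circ (p ^+ 2 - q ^+ 2) (2 * p * q) (2 * t) = circ p q t * circ p q (t + pi).
Proof.
rewrite /circ cosDpi sinDpi (_ : 2 * t = t + t); last by ring.
rewrite cosD sinD; have := cos2Dsin2 t; move: (cos t) (sin t) => c s h.
apply/eqP; rewrite -subr_eq0.
rewrite (_ : _ - _ = 2 * (p ^+ 2 + q ^+ 2) * (c ^+ 2 + s ^+ 2 - 1)); last by ring.
by rewrite h subrr mulr0.
Qed.

(** The triangle inequality for [|1 - b z|] with [|b| <= s]; the term linear in [cos t] and [sin t]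
    is bounded through Lagrange's identity. *)
Lemma circ_bounds p q s t : p ^+ 2 + q ^+ 2 <= s ^+ 2 -> 0 <= s <= 1 ->
  (1 - s) ^+ 2 <= circ p q t <= (1 + s) ^+ 2.
Proof.
move=> pq /andP[s0 s1].
set r := Num.sqrt (p ^+ 2 + q ^+ 2).
have r0 : 0 <= r by exact: sqrtr_ge0.
have rE : r ^+ 2 = p ^+ 2 + q ^+ 2 by rewrite sqr_sqrtr// addr_ge0 ?sqr_ge0.
have rs : r <= s by rewrite -(ler_pXn2r (n := 2)) ?nnegrE// rE.
have : `|p * cos t - q * sin t| <= r.
  rewrite -(ler_pXn2r (n := 2)) ?nnegrE ?normr_ge0// real_normK ?num_real// rE.
  have := cos2Dsin2 t; move: (cos t) (sin t) => c d h.
  have -> : p ^+ 2 + q ^+ 2 = (p ^+ 2 + q ^+ 2) * (c ^+ 2 + d ^+ 2) by rewrite h mulr1.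
  rewrite -subr_ge0 (_ : _ - _ = (p * d + q * c) ^+ 2) ?sqr_ge0//; ring.
rewrite ler_norml /circ => /andP[h1 h2].
have h3 : (1 - s) ^+ 2 <= (1 - r) ^+ 2 by nra.
have h4 : (1 + r) ^+ 2 <= (1 + s) ^+ 2 by nra.
by apply/andP; split; nra.
Qed.

Lemma continuous_circ p q : continuous (circ p q).
Proof.
move=> t; apply: cvgB; first exact: cvg_cst.
apply: cvgMr; apply: cvgB; apply: cvgMr; [exact: continuous_cos|exact: continuous_sin].
Qed.

Lemma circ_gt0 p q s t : p ^+ 2 + q ^+ 2 <= s ^+ 2 -> 0 <= s < 1 ->
  0 < circ p q t.
Proof.
move=> pq /andP[s0 s1]; have [|h _] := andP (circ_bounds t pq _).
  by rewrite s0 ltW.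
by apply: lt_le_trans h; rewrite exprn_gt0// subr_gt0.
Qed.

Lemma continuous_ln_circ p q s : p ^+ 2 + q ^+ 2 <= s ^+ 2 -> 0 <= s < 1 ->
  continuous (fun t => ln (circ p q t)).
Proof.
move=> pq /andP[s0 s1] t; apply: continuous_comp; first exact: continuous_circ.
by apply/continuous_ln/(circ_gt0 _ pq); rewrite s0.
Qed.

(** The upper bound [(1 + s) ^+ 2] is at most [(1 - s) ^- 2] because [(1 + s) * (1 - s) <= 1], so
    one constant serves both signs. *)
Lemma ln_circ_bound p q s t : p ^+ 2 + q ^+ 2 <= s ^+ 2 -> 0 <= s < 1 ->
  `|ln (circ p q t)| <= - (2 * ln (1 - s)).
Proof.
move=> pq /andP[s0 s1]; have [|h1 h2] := andP (circ_bounds t pq _).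
  by rewrite s0 ltW.
have s10 : 0 < 1 - s by rewrite subr_gt0.
have k0 : 0 < circ p q t by apply: lt_le_trans h1; rewrite exprn_gt0.
rewrite ler_norml opprK (_ : 2 * ln (1 - s) = ln ((1 - s) ^+ 2)); last first.
  by rewrite lnXn// mulr_natl.
rewrite ler_ln ?posrE ?exprn_gt0// h1/= -lnV ?posrE ?exprn_gt0//.
rewrite ler_ln ?posrE ?invr_gt0 ?exprn_gt0//.
rewrite (le_trans h2)// -exprVn lerXn2r ?nnegrE ?addr_ge0 ?invr_ge0 ?(ltW s10)//.
rewrite -[leRHS]mul1r ler_pdivlMr//; nra.
Qed.

Lemma circ_mean0_lt1 p q : p ^+ 2 + q ^+ 2 < 1 ->
  \int[mu]_(t in `[0, 2 * pi]) ln (circ p q t) = 0.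
Proof.
move=> pq1; pose s := Num.sqrt (p ^+ 2 + q ^+ 2).
have s2 : s ^+ 2 = p ^+ 2 + q ^+ 2 by rewrite sqr_sqrtr// addr_ge0 ?sqr_ge0.
have s01 : 0 <= s < 1.
  by rewrite sqrtr_ge0/= -(ltr_pXn2r (n := 2)) ?nnegrE ?sqrtr_ge0// s2 expr1n.
pose C := - (2 * ln (1 - s)) * (2 * pi).
(* Quantifying over all [b] with [|b| <= s] lets the induction pass from [b] to [b^2], since
   [s ^+ 2 <= s]; each doubling halves the bound. *)
have bound n : forall p q, p ^+ 2 + q ^+ 2 <= s ^+ 2 ->
    `|\int[mu]_(t in `[0, 2 * pi]) ln (circ p q t)| <= C / 2 ^+ n.
  elim: n => [|n IH] a b pq.
    rewrite expr0 divr1.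
    have int := continuous_itv_integrable 0 (2 * pi) (continuous_ln_circ pq s01).
    apply: le_trans (le_normr_Rintegral _ int) _; first exact: measurable_itv.
    apply: (@le_trans _ _ (\int[mu]_(t in `[0, 2 * pi]) - (2 * ln (1 - s)))).
      apply: le_Rintegral => //.
      - exact: (integrable_norm int).
      - exact/continuous_itv_integrable/cst_continuous.
      - by move=> t _; exact: ln_circ_bound.
    rewrite Rintegral_cst//= lebesgue_measure_itv/= lte_fin mulr_gt0 ?pi_gt0//=.
    by rewrite oppr0 addr0.
  have pq' : (a ^+ 2 - b ^+ 2) ^+ 2 + (2 * a * b) ^+ 2 <= s ^+ 2.
    rewrite (_ : _ + _ = (a ^+ 2 + b ^+ 2) ^+ 2); last by ring.
    have := sqr_ge0 a; have := sqr_ge0 b; case/andP: s01 => s0 s1; nra.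
  have := IH _ _ pq'.
  rewrite (@Rintegral_doubling (fun t => ln (circ a b t))).
  - by rewrite normrM ger0_norm// exprS invfM => h; move: h; lra.
  - exact: continuous_ln_circ pq s01.
  - exact: continuous_ln_circ pq' s01.
  - by move=> t; rewrite circ_sqr lnM// posrE (circ_gt0 _ pq).
apply/eqP; rewrite -normr_le0.
have cvg0 : C / 2 ^+ n @[n --> \oo] --> (0 : R).
  rewrite -(mulr0 C); under eq_fun do rewrite -exprVn.
  by apply: cvgMr; apply: cvg_expr; rewrite ger0_norm// invf_lt1// ltr1n.
rewrite -[leRHS](cvg_lim _ cvg0)//; apply: limr_ge; first exact: cvgP cvg0.
by near=> n; apply: bound; rewrite s2.
Unshelve. all: by end_near. Qed.

(** For [|b| = 1], [circ p q t] is [(cos t - p) ^+ 2 + (sin t + q) ^+ 2]. *)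
Lemma circ_eq0 p q t : p ^+ 2 + q ^+ 2 = 1 -> circ p q t = 0 -> cos t = p.
Proof.
rewrite /circ => pq h; have := cos2Dsin2 t.
move: (cos t) (sin t) h => c s h cs.
apply/eqP; rewrite -subr_eq0 -sqrf_eq0 eq_le sqr_ge0 andbT.
have := sqr_ge0 (s + q); nra.
Qed.

(** After division by [r], the right-hand side exceeds [circ p q t] by a quantity independent of [t]
    that tends to 0 as [r] tends to 1. *)
Lemma circ_scale p q r t : p ^+ 2 + q ^+ 2 = 1 ->
  circ (r * p) (r * q) t = r * circ p q t + (1 - r) ^+ 2.
Proof.
move=> pq; rewrite /circ -!addrA; move: (cos t) (sin t) => c s.
have -> : q ^+ 2 = 1 - p ^+ 2 by rewrite -pq addrC addKr.
have -> : (r * q) ^+ 2 = r ^+ 2 * (1 - p ^+ 2).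
  by rewrite exprMn -pq (addrC (p ^+ 2)) addrK.
ring.
Qed.

(** Confines the zeros of [circ p q] with [|b| = 1] to two points of a period, hence to a null
    set. *)
Lemma cos_preimage p : [set t | 0 <= t <= 2 * pi /\ cos t = p] `<=`
  [set acos p; 2 * pi - acos p].
Proof.
move=> t [/andP[t0 t2pi] <-].
have [tpi|pit] := leP t pi.
  by left; rewrite cosK// in_itv/= t0.
right => /=; have -> : cos t = cos (2 * pi - t).
  by rewrite mulr_natl -[RHS]cosN opprB -(cosD2pi (t - _)) subrK.
rewrite cosK ?subKr// in_itv/= subr_ge0 t2pi/=; lra.
Qed.

End CircleMean.

(** * Integrals off a null set and of functions bounded above *)

Section UpperBounded.
Context d (T : measurableType d) {R : realType}.
Variable mu : {measure set T -> \bar R}.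

Lemma ge0_integral_setD_null (D N : set T) (f : T -> \bar R) :
  measurable D -> measurable N -> mu N = 0%E -> measurable_fun D f ->
  (forall x, D x -> 0 <= f x)%E ->
  (\int[mu]_(x in D) f x = \int[mu]_(x in D `\` N) f x)%E.
Proof.
move=> mD mN N0 mf f0; rewrite setDE integral_mkcondr.
have mNC : measurable (~` N) by exact: measurableC.
apply: ge0_ae_eq_integral => //.
- by apply/measurable_restrict => //; apply: measurable_funS mf.
- by move=> x Dx; rewrite patchE; case: ifP => // _; exact: f0.
- exists N; split => // x /= /not_implyP[Dx]; rewrite patchE.
  by case: ifPn => //; rewrite notin_setE => /contrapT.
Qed.

Lemma lty_integrable_cst (D : set T) (c : R) : measurable D -> (mu D < +oo)%E ->
  mu.-integrable D (fun=> c%:E).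
Proof.
move=> mD Doo; apply/integrableP; split; first exact: measurable_cst.
rewrite (eq_integral (cst (`|c|)%:E))// integral_cst//.
exact: lte_mul_pinfty.
Qed.

(** The integral of the nonnegative [c - h] makes sense before integrability of [h] is known; its
    finiteness then yields that integrability. *)
Lemma integrable_ub (D : set T) (h : T -> R) (c v : R) :
  measurable D -> (mu D < +oo)%E -> measurable_fun D h ->
  (forall x, D x -> h x <= c) ->
  (\int[mu]_(x in D) (c - h x)%:E = v%:E)%E ->
  mu.-integrable D (EFin \o h) /\
  \int[mu]_(x in D) h x = c * fine (mu D) - v.
Proof.
move=> mD Doo mh hc E.
have ic := lty_integrable_cst c mD Doo.
have ich : mu.-integrable D (EFin \o (fun x => c - h x)).
  apply/integrableP; split.
    by apply/measurable_EFinP; apply: measurable_funB => //; exact: measurable_cst.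
  rewrite (eq_integral (fun x => (c - h x)%:E)) ?E ?ltry// => x.
  by rewrite inE => Dx /=; rewrite ger0_norm// subr_ge0 hc.
have ih : mu.-integrable D (EFin \o h).
  have := integrableB mD ic ich.
  by apply: eq_integrable => // x _ /=; rewrite -EFinB; congr EFin; ring.
split => //.
have : \int[mu]_(x in D) (c - h x) = v by rewrite /Rintegral E.
by rewrite RintegralB// Rintegral_cst//; lra.
Qed.

End UpperBounded.

(** * Logarithmic means when [b] lies on the unit circle *)

Section CircleMean1.
Context {R : realType}.
Implicit Types (p q t : R).
Local Notation mu := (@lebesgue_measure R).

Lemma measurable_ln_circ p q (D : set R) :
  measurable_fun D (fun t => ln (circ p q t)).
Proof.
apply: measurable_funTS; apply: measurableT_comp; first exact: measurable_ln.
by apply: continuous_measurable_fun; exact: continuous_circ.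
Qed.

Let period := `[0, 2 * pi : R]%classic.

Let mu_period : mu period = (2 * pi)%:E.
Proof.
by rewrite lebesgue_measure_itv/= lte_fin mulr_gt0 ?pi_gt0//= oppr0 addr0.
Qed.

(* As [r] increases to [1], [circ (r * p) (r * q) t / r] decreases to
   [circ p q t]; the logarithms of the former have mean [- ln r]. *)
Lemma circ_mean0_eq1 p q : p ^+ 2 + q ^+ 2 = 1 ->
  mu.-integrable `[0, 2 * pi] (fun t => (ln (circ p q t))%:E) /\
  \int[mu]_(t in `[0, 2 * pi]) ln (circ p q t) = 0.
Proof.
move=> pq.
have mP : measurable (period : set (measurableTypeR R)) by exact: measurable_itv.
pose r (n : nat) : R := n.+1%:R / n.+2%:R.
(* This is [(1 - r n) ^+ 2 / r n], the excess in [circ_scale] after division by [r n]. *)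
pose e (n : nat) : R := (n.+1%:R * n.+2%:R)^-1.
have r01 n : 0 < r n < 1.
  by rewrite divr_gt0//= ltr_pdivrMr// mul1r ltr_nat.
have e0 n : 0 < e n by rewrite invr_gt0 mulr_gt0.
have e1 n : e n <= 1.
  by rewrite invf_le1 ?mulr_gt0// -natrM ler1n.
have circ0 t : 0 <= circ p q t <= 4.
  have := @circ_bounds R p q 1 t; rewrite pq expr1n lexx ler01 subrr expr0n/=.
  by rewrite (_ : (1 + 1) ^+ 2 = 4 :> R); [apply|ring].
have circe n t : circ p q t + e n = circ (r n * p) (r n * q) t / r n.
  rewrite circ_scale// /r /e; field.
  by rewrite !lt0r_neq0// ltr_pwDl.
have cvge0 : e n @[n --> \oo] --> (0 : R).
  apply: (squeeze_cvgr (f := cst 0) (h := harmonic)).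
  - near=> n; rewrite /= (ltW (e0 n)) /e /harmonic/= lef_pV2 ?posrE ?mulr_gt0//.
    by rewrite ler_peMr// ler1n.
  - exact: cvg_cst.
  - exact: cvg_harmonic.
have cvgr1 : r n @[n --> \oo] --> (1 : R).
  apply: (squeeze_cvgr (f := fun n => 1 - harmonic n) (h := cst 1)).
  - near=> n; have /andP[_ /ltW ->] := r01 n; rewrite andbT /harmonic/=.
    have -> : r n = 1 - n.+2%:R^-1 by rewrite /r; field; rewrite lt0r_neq0// ltr_pwDl.
    by rewrite lerB// lef_pV2 ?posrE// ler_nat.
  - rewrite -[X in _ --> X]subr0; apply: cvgB; [exact: cvg_cst|exact: cvg_harmonic].
  - exact: cvg_cst.
(* The constant 5 comes from [circ p q t <= 4] and [e n <= 1]. *)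
have ln5 t n : ln (circ p q t + e n) <= ln 5.
  have := circ0 t; have := e0 n; have := e1 n => h1 h2 /andP[h3 h4].
  by rewrite ler_ln ?posrE//; lra.
(* At a zero of [circ p q] the value [ln 0 = 0] is not the limit of [ln (e n)], so the zeros are
   removed before passing to the limit. *)
pose N : set R := [set acos p; 2 * pi - acos p].
have mN : measurable N by exact: measurableU.
have N0 : mu N = 0%E.
  apply: countable_lebesgue_measure0; apply: finite_set_countable.
  by rewrite finite_setU; split; exact: finite_set1.
(* Subtracting from [ln 5] makes the functions nonnegative and nondecreasing in [n], as monotone
   convergence requires. *)
pose g (n : nat) (t : R) : \bar R := (ln 5 - ln (circ p q t + e n))%:E.
have mg n D : measurable_fun D (g n).
  apply: measurable_funTS; apply/measurable_EFinP.
  apply: measurable_funB; first exact: measurable_cst.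
  apply: measurableT_comp; first exact: measurable_ln.
  apply: measurable_funD; last exact: measurable_cst.
  by apply: continuous_measurable_fun; exact: continuous_circ.
have g0 n t : (0 <= g n t)%E by rewrite lee_fin subr_ge0.
have intg n : (\int[mu]_(t in period) g n t = (2 * pi * (ln 5 + ln (r n)))%:E)%E.
  have /andP[r0 r1] := r01 n.
  have rpq : (r n * p) ^+ 2 + (r n * q) ^+ 2 <= r n ^+ 2.
    by rewrite !exprMn -mulrDr pq mulr1.
  have rn : 0 <= r n < 1 by rewrite (ltW r0).
  have rpq1 : (r n * p) ^+ 2 + (r n * q) ^+ 2 < 1.
    by apply: (le_lt_trans rpq); rewrite expr_lt1// ltW.
  have ih := continuous_itv_integrable 0 (2 * pi) (continuous_ln_circ rpq rn).
  have ic := continuous_itv_integrable 0 (2 * pi) (@cst_continuous _ _ (ln 5 + ln (r n))).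
  have gE t : g n t = (ln 5 + ln (r n) - ln (circ (r n * p) (r n * q) t))%:E.
    rewrite /g circe ln_div ?posrE ?(circ_gt0 _ rpq rn)//; congr EFin; ring.
  transitivity (\int[mu]_(t in period)
      (ln 5 + ln (r n) - ln (circ (r n * p) (r n * q) t))%:E)%E.
    by apply: eq_integral => t _; exact: gE.
  rewrite -[LHS]fineK; last first.
    by apply: integrable_fin_num => //; exact: (integrableB mP ic ih).
  rewrite -[fine _]/(\int[mu]_(t in period)
    (ln 5 + ln (r n) - ln (circ (r n * p) (r n * q) t))).
  rewrite RintegralB// circ_mean0_lt1// Rintegral_cst//= lebesgue_measure_itv/=.
  by rewrite lte_fin mulr_gt0 ?pi_gt0//= oppr0 !addr0 mulrC.
have lim1 : (\int[mu]_(t in period `\` N) g n t)%E @[n --> \oo] -->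
    (\int[mu]_(t in period `\` N) (ln 5 - ln (circ p q t))%:E)%E.
  rewrite [X in _ --> X](_ : _ =
    (\int[mu]_(t in period `\` N) limn (g ^~ t))%E); last first.
    apply: eq_integral => t; rewrite inE/= => -[tP tN].
    apply/esym/cvg_lim => //; apply: cvg_EFin; first by near=> n.
    apply: cvgB; first exact: cvg_cst.
    apply: continuous_cvg.
      apply: continuous_ln.
      have /andP[+ _] := circ0 t; rewrite le_eqVlt => /predU1P[c0|//].
      exfalso; apply: tN; apply: cos_preimage; split.
        by move: tP; rewrite /period/= in_itv.
      exact: circ_eq0 pq (esym c0).
    rewrite -[X in _ --> X]addr0; apply: cvgD; first exact: cvg_cst.
    exact: cvge0.
  apply: cvg_monotone_convergence => //.
  - exact: measurableD.
  - by move=> n; exact: mg.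
  - move=> t _ m n mn; rewrite lee_fin lerB// ler_ln ?posrE.
    + rewrite lerD2l lef_pV2 ?posrE ?mulr_gt0//.
      by rewrite -!natrM ler_nat leq_mul.
    + have /andP[h _] := circ0 t; exact: ltr_wpDl.
    + have /andP[h _] := circ0 t; exact: ltr_wpDl.
have lim2 : (\int[mu]_(t in period `\` N) g n t)%E @[n --> \oo] --> (2 * pi * ln 5)%:E.
  have EN n : (\int[mu]_(t in period `\` N) g n t =
      (2 * pi * (ln 5 + ln (r n)))%:E)%E.
    rewrite -intg; apply/esym; apply: ge0_integral_setD_null => //.
    exact: mg.
  under eq_fun do rewrite EN.
  apply: cvg_EFin; first by near=> n.
  apply: cvgMr; rewrite -[X in _ --> X]addr0; apply: cvgD; first exact: cvg_cst.
  by rewrite -[X in _ --> X]ln1; apply: continuous_cvg cvgr1; exact: continuous_ln.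
have mln : measurable_fun period (fun t => ln (circ p q t)) by exact: measurable_ln_circ.
have lnc t : ln (circ p q t) <= ln 5.
  have /andP[+ h] := circ0 t; rewrite le_eqVlt => /predU1P[<-|c0].
    by rewrite ln0// ln_ge0// ler1n.
  by rewrite ler_ln ?posrE//; lra.
have E : (\int[mu]_(t in period) (ln 5 - ln (circ p q t))%:E = (2 * pi * ln 5)%:E)%E.
  rewrite (@ge0_integral_setD_null _ _ _ mu _ N)//.
  - exact: cvg_unique lim1 lim2.
  - by apply/measurable_EFinP/measurable_funB.
  - by move=> t _; rewrite lee_fin subr_ge0.
have [] := integrable_ub mP _ mln (fun t _ => lnc t) E.
  by rewrite /= mu_period ltry.
by move=> ih ->; split => //; rewrite /= mu_period/=; ring.
Unshelve. all: by end_near. Qed.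

Lemma circ_mean0 p q : p ^+ 2 + q ^+ 2 <= 1 ->
  mu.-integrable `[0, 2 * pi] (fun t => (ln (circ p q t))%:E) /\
  \int[mu]_(t in `[0, 2 * pi]) ln (circ p q t) = 0.
Proof.
rewrite le_eqVlt => /predU1P[|pq]; first exact: circ_mean0_eq1.
split; last exact: circ_mean0_lt1.
apply: continuous_itv_integrable.
apply: (@continuous_ln_circ R p q (Num.sqrt (p ^+ 2 + q ^+ 2))).
  by rewrite sqr_sqrtr// addr_ge0 ?sqr_ge0.
by rewrite sqrtr_ge0/= -sqrtr1 ltr_sqrt.
Qed.

End CircleMean1.

(** * Plane Lebesgue measure *)

Section Tonelli3.
Context d1 d2 d3 (T1 : measurableType d1) (T2 : measurableType d2)
  (T3 : measurableType d3) (R : realType).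
Variables (m1 : {sigma_finite_measure set T1 -> \bar R})
  (m2 : {sigma_finite_measure set T2 -> \bar R})
  (m3 : {sigma_finite_measure set T3 -> \bar R}).

(** The product measure is unfolded into iterated integrals, [m1] is exchanged with [m2] and then
    with [m3], and the product is folded back. *)
Lemma fubini_tonelli_prod (f : T1 * (T2 * T3) -> \bar R) :
  measurable_fun setT f -> (forall x, 0 <= f x)%E ->
  (\int[m1]_x \int[(m2 \x m3)%E]_y f (x, y) =
   \int[(m2 \x m3)%E]_y \int[m1]_x f (x, y))%E.
Proof.
move=> mf f0.
have mg : measurable_fun setT (fun p : (T1 * T2) * T3 => f (p.1.1, (p.1.2, p.2))).
  apply: (measurableT_comp mf); apply: measurable_fun_pair.
    exact: measurableT_comp measurable_fst measurable_fst.
  apply: measurable_fun_pair; last exact: measurable_snd.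
  exact: measurableT_comp measurable_snd measurable_fst.
have mF := @measurable_fun_fubini_tonelli_F _ _ _ _ _ m3 _ mg (fun=> f0 _).
transitivity (\int[m1]_x \int[m2]_y \int[m3]_z f (x, (y, z)))%E.
  apply: eq_integral => x _; rewrite fubini_tonelli1//.
  exact: (measurableT_comp mf (measurable_pair1 x)).
have := @fubini_tonelli _ _ _ _ _ m1 m2 _ mF (fun x => integral_ge0 _ (fun z _ => f0 _)).
rewrite /fubini_F/= => ->.
rewrite fubini_tonelli1//.
- apply: eq_integral => y _; rewrite /fubini_F.
  apply: (fubini_tonelli (fun p : T1 * T3 => f (p.1, (y, p.2)))) => //.
  apply: (measurableT_comp mf); apply: measurable_fun_pair.
    exact: measurable_fst.
  exact: (measurableT_comp (measurable_pair1 y) measurable_snd).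
- exact: (@measurable_fun_fubini_tonelli_G _ _ _ _ _ m1 f mf f0).
- by move=> y; apply: integral_ge0 => x _.
Qed.

End Tonelli3.

Section Plane.
Context {R : realType}.
Local Notation mu := (@lebesgue_measure R).
Local Notation TR := (measurableTypeR R).
Local Notation mu2 := (mu \x mu)%E.
Implicit Types (f : R * R -> \bar R) (k c s x y : R).

(** The pushforward under translation agrees with Lebesgue measure on half-open intervals, which
    determine it. *)
Lemma lebesgue_measure_translate k (A : set TR) : measurable A ->
  mu ((fun x => x + k) @^-1` A) = mu A.
Proof.
have mk : measurable_fun [set: TR] ((fun x => x + k) : TR -> TR).
  by apply: continuous_measurable_fun => x; apply: cvgD => //; exact: cvg_cst.
move=> mA; rewrite (@lebesgue_measure_unique R
  (pushforward mu (fun x : TR => (x + k : TR))) _ A)//.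
move=> X [[a b] _ <-] /=; rewrite /pushforward.
have -> : (fun x => x + k) @^-1` `]a, b] = `]a - k, b - k]%classic.
  by apply/seteqP; split => x /=; rewrite !in_itv/= ltrBlDr lerBrDr.
rewrite !lebesgue_measure_itv/= !lte_fin ltrD2r; case: ifP => // _.
by rewrite -!EFinB; congr EFin; ring.
Qed.

Lemma ge0_integral_translate (f : R -> \bar R) k : measurable_fun [set: TR] f ->
  (forall x, 0 <= f x)%E -> (\int[mu]_x f (x + k)%R = \int[mu]_x f x)%E.
Proof.
move=> mf f0.
have mk : measurable_fun [set: TR] ((fun x => x + k) : TR -> TR).
  by apply: continuous_measurable_fun => x; apply: cvgD => //; exact: cvg_cst.
have := @ge0_integral_pushforward _ _ _ _ R _ mk mu setT f measurableT mf (fun x _ => f0 x).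
rewrite preimage_setT => <-.
apply: eq_measure_integral => A mA _; exact: lebesgue_measure_translate.
Qed.

(** For fixed [z.2] the shear is a translation of [z.1], so [z.1] is integrated first. *)
Lemma ge0_integral_shear1 f k : measurable_fun [set: TR * TR] f ->
  (forall z, 0 <= f z)%E ->
  (\int[mu2]_z f (z.1 + k * z.2, z.2)%R = \int[mu2]_z f z)%E.
Proof.
move=> mf f0; rewrite !fubini_tonelli2//; last first.
  apply: measurableT_comp => //; apply: measurable_fun_pair.
    apply: measurable_funD; first exact: measurable_fst.
    by apply: measurable_funM; [exact: measurable_cst|exact: measurable_snd].
  exact: measurable_snd.
apply: eq_integral => y _; rewrite /fubini_G/=.
apply: (ge0_integral_translate (f := fun x => f (x, y))) => //.
apply: measurableT_comp => //; exact: measurable_pair2.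
Qed.

Lemma ge0_integral_shear2 f k : measurable_fun [set: TR * TR] f ->
  (forall z, 0 <= f z)%E ->
  (\int[mu2]_z f (z.1, z.2 + k * z.1)%R = \int[mu2]_z f z)%E.
Proof.
move=> mf f0; rewrite !fubini_tonelli1//; last first.
  apply: measurableT_comp => //; apply: measurable_fun_pair.
    exact: measurable_fst.
  apply: measurable_funD; first exact: measurable_snd.
  by apply: measurable_funM; [exact: measurable_cst|exact: measurable_fst].
apply: eq_integral => x _; rewrite /fubini_F/=.
apply: (ge0_integral_translate (f := fun y => f (x, y))) => //.
apply: measurableT_comp => //; exact: measurable_pair1.
Qed.

Lemma ge0_integral_rotate f c s : c ^+ 2 + s ^+ 2 = 1 ->
  measurable_fun [set: TR * TR] f -> (forall z, 0 <= f z)%E ->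
  (\int[mu2]_z f (c * z.1 - s * z.2, s * z.1 + c * z.2)%R = \int[mu2]_z f z)%E.
Proof.
have mS1 k : measurable_fun [set: TR * TR]
    ((fun z => (z.1 + k * z.2, z.2)%R) : TR * TR -> TR * TR).
  apply: measurable_fun_pair; last exact: measurable_snd.
  apply: measurable_funD; first exact: measurable_fst.
  by apply: measurable_funM; [exact: measurable_cst|exact: measurable_snd].
have mS2 k : measurable_fun [set: TR * TR]
    ((fun z => (z.1, z.2 + k * z.1)%R) : TR * TR -> TR * TR).
  apply: measurable_fun_pair; first exact: measurable_fst.
  apply: measurable_funD; first exact: measurable_snd.
  by apply: measurable_funM; [exact: measurable_cst|exact: measurable_fst].
(* A rotation by an angle [t] with [sin t != 0] is a product of three shears. *)
have rot f' c' s' : s' != 0 -> c' ^+ 2 + s' ^+ 2 = 1 ->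
    measurable_fun [set: TR * TR] f' -> (forall z, 0 <= f' z)%E ->
    (\int[mu2]_z f' (c' * z.1 - s' * z.2, s' * z.1 + c' * z.2)%R =
     \int[mu2]_z f' z)%E.
  (* For the angle [t], [k] is [- tan (t / 2)]; the shears have coefficients [k], [s'], [k]. *)
  move=> s0 cs mf f0; pose k := - ((1 - c') / s').
  rewrite -(ge0_integral_shear1 (f := f') k)//.
  rewrite -(ge0_integral_shear2
    (f := fun z => f' (z.1 + k * z.2, z.2)%R) s')//; last first.
    exact: measurableT_comp mf (mS1 _).
  rewrite -(ge0_integral_shear1 (f := fun z =>
    f' (z.1 + k * (z.2 + s' * z.1), z.2 + s' * z.1)%R) k)//; last first.
    exact: (measurableT_comp (measurableT_comp mf (mS1 k)) (mS2 s')).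
  apply: eq_integral => -[x y] _ /=; congr (f' (_, _)).
  - have E : s' = (1 - c' ^+ 2) / s' by rewrite -cs addrC addKr expr2 mulfK.
    by rewrite {1}E /k; field.
  - by rewrite /k; field.
move=> cs mf f0; have [s0|] := eqVneq s 0; last by move=> ?; exact: rot.
move: cs; rewrite s0 expr0n addr0 => /eqP; rewrite sqrf_eq1 => /orP[]/eqP ->.
  by apply: eq_integral => -[x y] _ /=; rewrite !mul1r !mul0r subr0 add0r.
(* The half-turn [c = -1] is a product of two quarter-turns, which [rot] covers. *)
rewrite -(rot f 0 1)//; last by rewrite expr0n expr1n add0r.
rewrite -(rot (fun z => f (0 * z.1 - 1 * z.2, 1 * z.1 + 0 * z.2)%R) 0 1)//.
- by apply: eq_integral => -[x y] _ /=; congr (f (_, _)); ring.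
- by rewrite expr0n expr1n add0r.
- have m1 : measurable_fun [set: TR * TR]
      ((fun z => (0 * z.1 - 1 * z.2, 1 * z.1 + 0 * z.2)%R) : TR * TR -> TR * TR).
    apply: measurable_fun_pair.
      by apply: measurable_funB; apply: measurable_funM;
        [exact: measurable_cst|exact: measurable_fst|exact: measurable_cst|exact: measurable_snd].
    by apply: measurable_funD; apply: measurable_funM;
        [exact: measurable_cst|exact: measurable_fst|exact: measurable_cst|exact: measurable_snd].
  exact: measurableT_comp mf m1.
Qed.
Lemma is_derive_FTC2 (F f : R -> R) (a b : R) : a < b ->
  (forall x, a <= x <= b -> is_derive x 1 F (f x)) ->
  {within `[a, b], continuous f} ->
  (\int[mu]_(x in `[a, b]) (f x)%:E)%E = (F b - F a)%:E.
Proof.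
move=> ab dF cf; have dF' x : x \in `]a, b[ -> is_derive x 1 F (f x).
  by rewrite in_itv/= => /andP[ax xb]; apply: dF; rewrite !ltW.
have Fc x : a <= x <= b -> {for x, continuous F}.
  by case/dF => ? _; apply/differentiable_continuous/derivable1_diffP.
rewrite (continuous_FTC2 ab cf (F := F))//.
- split; first by move=> x /dF'[].
    by apply/cvg_at_right_filter/Fc; rewrite lexx ltW.
  by apply/cvg_at_left_filter/Fc; rewrite lexx ltW.
- by move=> x /dF'[_ FE]; rewrite derive1E.
Qed.

(** Here [r] is the squared radius. The vertical chords have length [2 * Num.sqrt (r - x ^+ 2)],
    integrated by the substitution [x = s * sin t] with [s = Num.sqrt r]. *)
Lemma area_disk (r : R) : 0 <= r ->
  mu2 [set z : TR * TR | z.1 ^+ 2 + z.2 ^+ 2 < r] = (pi * r)%:E.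
Proof.
rewrite le_eqVlt => /predU1P[<-|r0].
  rewrite mulr0 [X in mu2 X](_ : _ = set0) ?measure0//.
  by apply/seteqP; split => // z /=; rewrite ltNge addr_ge0 ?sqr_ge0.
rewrite /product_measure1/=.
pose s := Num.sqrt r.
have s0 : 0 < s by rewrite sqrtr_gt0.
have sE : s ^+ 2 = r by rewrite sqr_sqrtr// ltW.
transitivity (\int[mu]_(x in `[(- s)%R, s]) (2 * Num.sqrt (r - x ^+ 2))%:E)%E.
  rewrite [RHS]integral_mkcond; apply: eq_integral => x _.
  rewrite patchE mem_setE in_itv/= -ler_norml.
  have xE : xsection [set z : TR * TR | z.1 ^+ 2 + z.2 ^+ 2 < r] x =
      `]- Num.sqrt (r - x ^+ 2), Num.sqrt (r - x ^+ 2)[%classic.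
    apply/seteqP; split => y; rewrite /xsection/= inE/= in_itv/= -ltr_norml.
      move=> h; have h0 : 0 < r - x ^+ 2.
        by rewrite subr_gt0 (le_lt_trans _ h)// lerDl sqr_ge0.
      by rewrite -sqrtr_sqr ltr_sqrt// ltrBrDl.
    move=> h; rewrite -ltrBrDl -(real_normK (num_real y)).
    have h0 : 0 < r - x ^+ 2 by rewrite -sqrtr_gt0 (le_lt_trans _ h).
    by rewrite -(sqr_sqrtr (ltW h0)) ltr_pXn2r ?nnegrE.
  rewrite xE lebesgue_measure_itv/= lte_fin -subr_gt0 opprK.
  rewrite -mulr2n pmulrn_lgt0// sqrtr_gt0 subr_gt0.
  have -> : (x ^+ 2 < r) = (`|x| < s).
    by rewrite -(real_normK (num_real x)) -sE ltr_pXn2r ?nnegrE// ltW.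
  case: ltgtP => // h.
  - by rewrite -EFinD -mulr2n mulr_natl.
  - by rewrite -(real_normK (num_real x)) h sE subrr sqrtr0 mulr0.
have sinE : `[- s, s]%classic = `[s * sin (- (pi / 2)), s * sin (pi / 2)]%classic.
  by rewrite sinN sin_pihalf mulrN mulr1.
rewrite sinE.
have dF x : is_derive x 1 (fun t : R => s * sin t) (s * cos x).
  by apply: is_derive_eq.
have dFE : (fun t : R => s * sin t)^`()%classic = (fun t => s * cos t).
  by apply/funext => x; rewrite derive1E; have [_ ->] := dF x.
have cF : continuous (fun t : R => s * sin t).
  by move=> x; apply: cvgMr; exact: continuous_sin.
have cdF : continuous (fun t : R => s * cos t).
  by move=> x; apply: cvgMr; exact: continuous_cos.
have pi2 : - (pi / 2) < pi / 2 :> R by have := pi_gt0 R; lra.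
rewrite (@integration_by_substitution_increasing R (fun t => s * sin t)
  (fun x => 2 * Num.sqrt (r - x ^+ 2)) (- (pi / 2)) (pi / 2)).
- rewrite dFE.
  transitivity (\int[mu]_(x in `[(- (pi / 2))%R, (pi / 2)%R]) (2 * r * cos x ^+ 2)%:E)%E.
    apply: eq_integral => x; rewrite inE/= in_itv/= => xpi; congr EFin.
    rewrite fctE/= exprMn sE.
    have -> : r - r * sin x ^+ 2 = s ^+ 2 * cos x ^+ 2.
      have -> : cos x ^+ 2 = 1 - sin x ^+ 2 by rewrite -(cos2Dsin2 x) addrK.
      by rewrite sE; ring.
    have c0 : 0 <= cos x by exact: cos_ge0_pihalf.
    by rewrite -exprMn sqrtr_sqr ger0_norm ?mulr_ge0 ?(ltW s0)// -sE; ring.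
  have dG x : is_derive x 1 (fun t : R => r * (t + sin t * cos t)) (2 * r * cos x ^+ 2).
    apply: is_derive_eq; rewrite /GRing.scale/=.
    have := cos2Dsin2 x; move: (cos x) (sin x) => c u h.
    have u2 : u ^+ 2 = 1 - c ^+ 2 by rewrite -h addrAC subrr add0r.
    by rewrite mulrN -expr2 u2; ring.
  rewrite (@is_derive_FTC2 (fun t => r * (t + sin t * cos t))
    (fun x => 2 * r * cos x ^+ 2) _ _ pi2)//.
  + by rewrite cosN cos_pihalf !mulr0 !addr0; congr EFin; field.
  + apply: continuous_subspaceT => x; apply: cvgMr.
    rewrite expr2; under eq_fun do rewrite expr2.
    by apply: cvgM; exact: continuous_cos.
- exact: ltW.
- by move=> x y xpi ypi xy; rewrite ltr_pM2l// ltr_sin.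
- by rewrite dFE => x _; exact: cdF.
- by rewrite dFE; apply: cvgP; apply: cvg_at_right_filter; exact: cdF.
- by rewrite dFE; apply: cvgP; apply: cvg_at_left_filter; exact: cdF.
- split; first by move=> x _; have [] := dF x.
    exact/cvg_at_right_filter/cF.
  exact/cvg_at_left_filter/cF.
- apply: continuous_subspaceT => x; apply: cvgMr.
  apply: continuous_comp; last exact: sqrt_continuous.
  apply: cvgB; [exact: cvg_cst|exact: exprn_continuous].
Qed.

Lemma measurable_sqr_norm :
  measurable_fun [set: TR * TR] (fun z : TR * TR => z.1 ^+ 2 + z.2 ^+ 2 : R).
Proof.
by apply: measurable_funD; apply: measurable_funX;
  [exact: measurable_fst|exact: measurable_snd].
Qed.

Lemma measurable_disk (r : R) :
  measurable [set z : TR * TR | z.1 ^+ 2 + z.2 ^+ 2 < r].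
Proof.
rewrite (_ : [set _ | _] = setT `&`
    (fun z : TR * TR => z.1 ^+ 2 + z.2 ^+ 2 : R) @^-1` `]-oo, r[%classic).
  exact: measurable_sqr_norm.
by rewrite setTI; apply/seteqP; split => z /=; rewrite in_itv.
Qed.

Lemma integral_inv (a b : R) : 0 < a -> a <= b ->
  (\int[mu]_(x in `[a, b]) (x^-1)%:E = (ln b - ln a)%:E)%E.
Proof.
move=> a0; rewrite le_eqVlt => /predU1P[->|ab].
  by rewrite set_itv1 integral_set1 subrr.
have x0 x : a <= x <= b -> 0 < x by move=> /andP[ax _]; exact: lt_le_trans ax.
apply: is_derive_FTC2 => //.
  by move=> x /x0; exact: is_derive1_ln.
apply: continuous_in_subspaceT => x; rewrite inE/= in_itv/= => /x0 xp.
exact/inv_continuous/lt0r_neq0.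
Qed.

(* [- ln (max |z|^2 a)] is the integral of [1 / x] over the [x] in [[a, 1]]
   such that [z] belongs to the disk of area [pi * x]. *)
Lemma integral_disk_ln_max (a : R) : 0 < a < 1 ->
  (\int[mu2]_(z in [set z : TR * TR | (z.1 ^+ 2 + z.2 ^+ 2 < 1)%R])
    (- ln (Num.max (z.1 ^+ 2 + z.2 ^+ 2) a))%:E = (pi * (1 - a))%:E)%E.
Proof.
move=> /andP[a0 a1].
(* [expR (- ln p.1)] equals [p.1^-1] for positive [p.1] and is measurable as a composition. *)
pose g (p : TR * (TR * TR)) : \bar R :=
  (expR (- ln p.1) * \1_`[a, 1]%classic p.1 *
   \1_[set q : TR * (TR * TR) | q.2.1 ^+ 2 + q.2.2 ^+ 2 < q.1] p)%:E.
have g0 p : (0 <= g p)%E by rewrite lee_fin !mulr_ge0// expR_ge0.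
have mw : measurable_fun setT
    (fun q : TR * (TR * TR) => q.2.1 ^+ 2 + q.2.2 ^+ 2 - q.1 : R).
  apply: measurable_funB; last exact: measurable_fst.
  exact: measurableT_comp measurable_sqr_norm measurable_snd.
have mB : measurable [set q : TR * (TR * TR) | q.2.1 ^+ 2 + q.2.2 ^+ 2 < q.1].
  rewrite (_ : [set _ | _] = setT `&` (fun q : TR * (TR * TR) =>
      q.2.1 ^+ 2 + q.2.2 ^+ 2 - q.1 : R) @^-1` `]-oo, 0[%classic).
    exact: mw.
  by rewrite setTI; apply/seteqP; split => z /=; rewrite in_itv/= subr_lt0.
have mg : measurable_fun setT g.
  apply/measurable_EFinP; apply: measurable_funM; last exact: measurable_indic.
  apply: measurable_funM; last first.
    by apply: (measurableT_comp _ measurable_fst); exact: measurable_indic.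
  apply: measurableT_comp; first exact: measurable_expR.
  apply: measurableT_comp; first exact: oppr_measurable.
  apply: measurableT_comp; first exact: measurable_ln.
  exact: measurable_fst.
have expR_ln x : 0 < x -> expR (- ln x) = x^-1.
  by move=> x0; rewrite expRN lnK.
have := @fubini_tonelli_prod _ _ _ TR TR TR R mu mu mu g mg g0.
set lhs := (X in X = _ -> _); set rhs := (X in _ = X -> _) => E.
transitivity rhs.
  rewrite /rhs integral_mkcond; apply: eq_integral => z _.
  rewrite patchE.
  set w := z.1 ^+ 2 + z.2 ^+ 2.
  (* [S] is empty if [1 <= w], all of [[a, 1]] if [w < a], and []w, 1]] otherwise. *)
  pose S := [set x | a <= x <= 1 /\ w < x].
  have gE : (\int[mu]_x g (x, z) = \int[mu]_(x in S) (x^-1)%:E)%E.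
    rewrite [RHS]integral_mkcond; apply: eq_integral => x _.
    rewrite patchE /g/= !indicE mem_setE in_itv/=.
    case: (boolP (x \in S)) => [|xS].
      rewrite inE => -[/andP[ax x1] wx]; rewrite ax x1 mem_set//= !mulr1.
      by rewrite expR_ln// (lt_le_trans a0).
    case: (boolP (a <= x <= 1)) => ax; last by rewrite mulr0 mul0r.
    by rewrite memNset ?mulr0//= => wx; move: xS; rewrite notin_setE; apply.
  rewrite gE; have [w1|w1] := ltP w 1; last first.
    rewrite memNset/=; last by apply/negP; rewrite -leNgt.
    rewrite (_ : S = set0) ?integral_set0//; apply/seteqP; split => // x.
    by move=> [/andP[_ x1] wx]; have := lt_le_trans wx x1; rewrite ltNge w1.
  rewrite mem_set//=; have [wa|aw] := ltP w a.
    rewrite (_ : S = `[a, 1]%classic) ?integral_inv ?(ltW a1)// ?ln1 ?sub0r//.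
    apply/seteqP; split => x /=; rewrite in_itv/=; first by case.
    by move=> ax; split => //; case/andP: ax => ax _; exact: lt_le_trans ax.
  have w0 : 0 < w by exact: lt_le_trans aw.
  rewrite (_ : S = `]w, 1]%classic); last first.
    apply/seteqP; split => x /=; rewrite in_itv/=.
      by move=> [/andP[_ ->] ->].
    by move=> /andP[wx x1]; split => //; rewrite x1 (le_trans aw (ltW wx)).
  rewrite integral_itv_obnd_cbnd ?integral_inv ?(ltW w1)// ?ln1 ?sub0r//.
  apply: (@eq_measurable_fun _ _ _ _ _ (fun x : R => (expR (- ln x))%:E)).
    move=> x; rewrite inE/= in_itv/= => /andP[wx _].
    by rewrite expR_ln// (lt_trans w0).
  apply: measurable_funTS; apply/measurable_EFinP.
  apply: measurableT_comp; first exact: measurable_expR.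
  apply: measurableT_comp; first exact: oppr_measurable.
  exact: measurable_ln.
rewrite -E /lhs.
(* For fixed [x], the factor [1 / x] cancels against the area [pi * x]. *)
transitivity (\int[mu]_(x in `[a, 1%R]) (cst pi%:E x))%E.
  rewrite [RHS]integral_mkcond; apply: eq_integral => x _.
  rewrite patchE mem_setE in_itv/=; case: ifPn => [/andP[ax x1]|xa]; last first.
    apply: integral0_eq => z _; rewrite /g/= indicE mem_setE in_itv/=.
    by rewrite (negbTE xa) mulr0 mul0r.
  have x0 : 0 < x by exact: lt_le_trans ax.
  transitivity (\int[mu2]_z ((x^-1)%:E *
      (\1_[set z : TR * TR | z.1 ^+ 2 + z.2 ^+ 2 < x] z)%:E))%E.
    apply: eq_integral => z _.
    by rewrite /g/= indicE mem_setE in_itv/= ax x1 mulr1 expR_ln.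
  rewrite ge0_integralZl//.
  - rewrite integral_indic// ?setIT; last exact: measurable_disk.
    by rewrite [X in (_ * X)%E](area_disk (ltW x0)) -EFinM mulrCA mulVf ?mulr1// lt0r_neq0.
  - by apply/measurable_EFinP/measurable_indic; exact: measurable_disk.
  - by rewrite lee_fin invr_ge0 ltW.
rewrite integral_cst//= lebesgue_measure_itv/= lte_fin a1.
by rewrite -EFinB -EFinM.
Qed.

End Plane.

(** * Integrals of logarithms of products *)

Section LogIntegral.
Context d (T : measurableType d) {R : realType}.
Variable mu : {measure set T -> \bar R}.
Variable D : set T.
Hypotheses (mD : measurable D) (Doo : (mu D < +oo)%E).
Implicit Types (g h : T -> R) (v w : R).

(** As [ln 0 = 0], [ln] is additive on products only off the zeros; asking these to be negligible
    makes the notion stable under products. *)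
Definition log_integral g v :=
  [/\ measurable_fun D g, forall x, D x -> 0 <= g x,
      mu.-negligible (D `&` [set x | g x = 0]),
      mu.-integrable D (fun x => (ln (g x))%:E) &
      \int[mu]_(x in D) ln (g x) = v].

Lemma log_integralM g h v w : log_integral g v -> log_integral h w ->
  log_integral (fun x => g x * h x) (v + w).
Proof.
move=> [mg g0 ng ig <-] [mh h0 nh ih <-].
have mgh : measurable_fun D (fun x => g x * h x) by exact: measurable_funM.
have ngh : mu.-negligible (D `&` [set x | g x * h x = 0]).
  apply: negligibleS (negligibleU ng nh) => x [Dx /= /eqP].
  by rewrite mulf_eq0 => /orP[]/eqP ?; [left|right].
have igh : mu.-integrable D (fun x => (ln (g x) + ln (h x))%:E).
  exact: (integrableD mD ig ih).
have mlgh : measurable_fun D (fun x => (ln (g x * h x))%:E).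
  by apply/measurable_EFinP; apply: measurableT_comp => //; exact: measurable_ln.
have ae : ae_eq mu D (fun x => (ln (g x) + ln (h x))%:E)
    (fun x => (ln (g x * h x))%:E).
  apply: negligibleS ngh => x /= /not_implyP[Dx]; split => //=.
  have := g0 x Dx; rewrite le_eqVlt => /predU1P[<-|gx0]; first by rewrite mul0r.
  have := h0 x Dx; rewrite le_eqVlt => /predU1P[<-|hx0]; first by rewrite mulr0.
  by exfalso; apply: b; rewrite lnM ?posrE.
split => //.
- by move=> x Dx; rewrite mulr_ge0 ?g0 ?h0.
- apply/integrableP; split => //.
  have /integrableP[mgh' ] := igh.
  rewrite (@ae_eq_integral _ _ _ mu D (fun x => `|(ln (g x * h x))%:E|%E))//.
  + exact: measurableT_comp.
  + exact: measurableT_comp.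
  + exact: ae_eq_comp ae.
- rewrite -RintegralD// /Rintegral; congr fine.
  apply/esym; apply: ae_eq_integral => //.
  by case/integrableP: igh.
Qed.

Lemma log_integral_cst c : 0 < c -> log_integral (fun=> c) (ln c * fine (mu D)).
Proof.
move=> c0; split.
- exact: measurable_cst.
- by move=> x _; exact: ltW.
- rewrite [X in _.-negligible X](_ : _ = set0); first exact: negligible_set0.
  by apply/seteqP; split => // x [_ /= c00]; rewrite c00 ltxx in c0.
- exact: lty_integrable_cst.
- by rewrite Rintegral_cst.
Qed.

(** Passes from squared moduli to moduli; [ln (Num.sqrt x) = ln x / 2] also holds at [x = 0], where
    both logarithms are 0. *)
Lemma log_integral_sqrt g v : log_integral g v ->
  log_integral (fun x => Num.sqrt (g x)) (v / 2).
Proof.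
move=> [mg g0 ng ig <-].
have lnE x : D x -> ln (Num.sqrt (g x)) = 2^-1 * ln (g x).
  move=> /g0; rewrite le_eqVlt => /predU1P[<-|gx0].
    by rewrite sqrtr0 ln0// mulr0.
  suff -> : ln (g x) = 2 * ln (Num.sqrt (g x)) by rewrite mulKf.
  by rewrite -{1}(sqr_sqrtr (ltW gx0)) lnXn ?sqrtr_gt0// mulr_natl.
have msq : measurable_fun D (fun x => Num.sqrt (g x)).
  apply: (measurableT_comp _ mg); apply: continuous_measurable_fun.
  exact: sqrt_continuous.
split => //.
- apply: negligibleS ng => x [Dx /= /eqP]; rewrite sqrtr_eq0 => gx0.
  by split => //=; apply/eqP; rewrite eq_le gx0 g0.
- have := integrableZl mD 2^-1 ig.
  by apply: eq_integrable => // x; rewrite inE => Dx; rewrite lnE.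
- rewrite mulrC -RintegralZl//; apply: eq_Rintegral => x.
  by rewrite inE => Dx; rewrite lnE.
Qed.

Lemma log_integral_prod (I : eqType) (s : seq I) (g : I -> T -> R) (v : I -> R) (c : R) :
  0 < c -> (forall i, i \in s -> log_integral (g i) (v i)) ->
  log_integral (fun x => c * \prod_(i <- s) g i x)
    (ln c * fine (mu D) + \sum_(i <- s) v i).
Proof.
move=> c0; elim: s => [|i s IH] gv.
  rewrite big_nil addr0; have := log_integral_cst c0.
  congr log_integral; apply/funext => x; by rewrite big_nil mulr1.
rewrite big_cons addrCA.
rewrite (_ : (fun x => _) = (fun x => g i x * (c * \prod_(j <- s) g j x))); last first.
  by apply/funext => x; rewrite big_cons mulrCA.
apply: log_integralM; first by apply: gv; rewrite mem_head.
by apply: IH => j js; apply: gv; rewrite in_cons js orbT.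
Qed.

Lemma eq_log_integral g h v : {in D, g =1 h} -> log_integral g v ->
  log_integral h v.
Proof.
move=> gh [mg g0 ng ig <-]; split.
- exact: eq_measurable_fun mg.
- by move=> x Dx; rewrite -gh ?inE// g0.
- by apply: negligibleS ng => x [Dx /= hx]; split => //=; rewrite gh ?inE.
- by apply: eq_integrable ig => // x Dx; rewrite gh.
- by apply: eq_Rintegral => x Dx; rewrite gh.
Qed.

End LogIntegral.

(** * Means of [ln |z - w|^2] over circles and over the unit disk *)

Section LogMeans.
Context {R : realType}.
Local Notation mu := (@lebesgue_measure R).
Local Notation TR := (measurableTypeR R).
Local Notation mu2 := (mu \x mu)%E.
Local Notation period := (`[0, 2 * pi : R]%classic : set TR).
Local Notation disk := [set z : TR * TR | (z.1 ^+ 2 + z.2 ^+ 2 < 1)%R].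
Implicit Types (a b p q x y t : R).

Lemma measurable_period : measurable period.
Proof. exact: measurable_itv. Qed.

Lemma lebesgue_measure_period : mu period = (2 * pi)%:E.
Proof.
by rewrite lebesgue_measure_itv/= lte_fin mulr_gt0 ?pi_gt0//= oppr0 addr0.
Qed.

Lemma lebesgue_measure_period_lty : (mu period < +oo)%E.
Proof. by rewrite lebesgue_measure_period ltry. Qed.

Lemma measure_disk1 : mu2 disk = pi%:E.
Proof. by rewrite area_disk// mulr1. Qed.

Lemma circ_log_integral p q : p ^+ 2 + q ^+ 2 <= 1 ->
  log_integral mu period (circ p q) 0.
Proof.
move=> pq; have [ic c0] := circ_mean0 pq.
split => //.
- apply: measurable_funTS; apply: continuous_measurable_fun; exact: continuous_circ.
- move=> t _; have := @circ_bounds R p q 1 t.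
  by rewrite expr1n ler01 lexx subrr expr0n/= => /(_ pq isT)/andP[].
- move: pq; rewrite le_eqVlt => /predU1P[pq|pq].
    exists [set acos p; 2 * pi - acos p]; split; first exact: measurableU.
      apply: countable_lebesgue_measure0; apply: finite_set_countable.
      by rewrite finite_setU; split; exact: finite_set1.
    move=> t [/= tP ct0]; apply: cos_preimage; split; last exact: circ_eq0 ct0.
    by move: tP; rewrite in_itv.
  rewrite [X in _.-negligible X](_ : _ = set0); first exact: negligible_set0.
  apply/seteqP; split => // t [_ /= ct0].
  have := @circ_gt0 R p q (Num.sqrt (p ^+ 2 + q ^+ 2)) t.
  rewrite sqr_sqrtr ?addr_ge0 ?sqr_ge0// lexx sqrtr_ge0 -sqrtr1 ltr_sqrt// pq ct0.
  by rewrite ltxx => /(_ isT isT).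
Qed.

(** With [z = x + iy] and [w = a + ib], the integrand is [|e^(it) z - w|^2 = m * circ p q t], where
    [p + iq] is [z] times the conjugate of [w], divided by [m]. Its squared modulus is [n / m <= 1],
    so only [ln m] contributes. *)
Lemma circle_log_integral x y a b : a ^+ 2 + b ^+ 2 != 0 ->
  log_integral mu period
    (fun t => (cos t * x - sin t * y - a) ^+ 2 + (sin t * x + cos t * y - b) ^+ 2)
    (2 * pi * ln (Num.max (x ^+ 2 + y ^+ 2) (a ^+ 2 + b ^+ 2))).
Proof.
move=> ab0; set m := Num.max _ _.
have m0 : 0 < m.
  by rewrite lt_max; apply/orP; right; rewrite lt_neqAle eq_sym ab0 addr_ge0 ?sqr_ge0.
pose p := (x * a + y * b) / m; pose q := (y * a - x * b) / m.
pose n := Num.min (x ^+ 2 + y ^+ 2) (a ^+ 2 + b ^+ 2).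
have mDn : m + n = x ^+ 2 + y ^+ 2 + (a ^+ 2 + b ^+ 2).
  by rewrite /m /n addr_max_min.
have mMn : m * n = (x ^+ 2 + y ^+ 2) * (a ^+ 2 + b ^+ 2).
  by rewrite /m /n; case: leP => _ //; rewrite mulrC.
have nm : n <= m by rewrite /n /m ge_min le_max lexx.
have pqE : p ^+ 2 + q ^+ 2 = n / m.
  have -> : p ^+ 2 + q ^+ 2 = (x ^+ 2 + y ^+ 2) * (a ^+ 2 + b ^+ 2) / m ^+ 2.
    by rewrite /p /q; field; rewrite lt0r_neq0.
  by rewrite -mMn; field; rewrite lt0r_neq0.
have pq1 : p ^+ 2 + q ^+ 2 <= 1 by rewrite pqE ler_pdivrMr// mul1r.
have := log_integralM measurable_period
  (log_integral_cst measurable_period lebesgue_measure_period_lty m0)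
  (circ_log_integral pq1).
rewrite [X in fine X]lebesgue_measure_period/= addr0 [ln m * _]mulrC.
apply: (eq_log_integral measurable_period) => t _.
rewrite /circ -(addrA 1) pqE; have := cos2Dsin2 t; move: (cos t) (sin t) => c s h.
have -> : m * (1 + n / m - 2 * (p * c - q * s)) =
    m + n - 2 * ((x * a + y * b) * c - (y * a - x * b) * s).
  by rewrite /p /q; field; rewrite lt0r_neq0.
rewrite mDn.
have -> : x ^+ 2 + y ^+ 2 = (x ^+ 2 + y ^+ 2) * (c ^+ 2 + s ^+ 2) by rewrite h mulr1.
ring.
Qed.

Lemma integral_cst_sub d (T : measurableType d) (m : {measure set T -> \bar R})
    (D : set T) (h : T -> R) (c : R) : measurable D -> (m D < +oo)%E ->
  m.-integrable D (fun z : T => (h z)%:E) ->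
  (\int[m]_(z in D) (c - h z)%:E = (c * fine (m D) - \int[m]_(z in D) h z)%:E)%E.
Proof.
move=> mD Doo ih.
have ic := lty_integrable_cst c mD Doo.
rewrite (eq_integral (fun z : T => c%:E - (h z)%:E)%E)// integralB//.
rewrite integral_cst// EFinB EFinM fineK ?ge0_fin_numE//; congr (_ - _)%E.
by rewrite fineK// integrable_fin_num.
Qed.

(** For [a > 0], the mean of [ln |z - w|^2] over the unit disk when [|w|^2 = a]. *)
Definition disk_mean a : R := if a < 1 then a - 1 else ln a.

(** For [a < 1] the integrand is a sum of two nonnegative terms and its integral splits; for
    [1 <= a] the maximum is constantly [a] on the disk. *)
Lemma integral_disk_radial a c : 0 < a -> 0 <= c ->
  ((\int[mu2]_(z in disk) (c - ln (Num.max (z.1 ^+ 2 + z.2 ^+ 2) a))%:E) =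
   (pi * (c - disk_mean a))%:E)%E.
Proof.
move=> a0 c0; rewrite /disk_mean; have [a1|a1] := ltP a 1.
  have ln0' z : disk z -> 0 <= - ln (Num.max (z.1 ^+ 2 + z.2 ^+ 2) a).
    by move=> /= z1; rewrite oppr_ge0 ln_le0// ge_max (ltW z1) (ltW a1).
  rewrite (eq_integral (fun z : TR * TR => (c%:E +
    (- ln (Num.max (z.1 ^+ 2 + z.2 ^+ 2) a))%:E)%E))//.
  rewrite ge0_integralD//.
  - rewrite integral_cst; last exact: measurable_disk.
    rewrite integral_disk_ln_max ?a0// [X in (_ * X)%E]measure_disk1 -EFinM -EFinD.
    by congr EFin; ring.
  - exact: measurable_disk.
  - apply: measurable_funTS; apply/measurable_EFinP.
    apply: measurableT_comp; first exact: oppr_measurable.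
    apply: measurableT_comp; first exact: measurable_ln.
    apply: measurable_maxr; [exact: measurable_sqr_norm|exact: measurable_cst].
rewrite (eq_integral (cst (c - ln a)%:E)).
  rewrite integral_cst; last exact: measurable_disk.
  by rewrite [X in (_ * X)%E]measure_disk1 -EFinM mulrC.
move=> z; rewrite inE/= => z1; congr (c - ln _)%:E.
by apply/max_idPr; rewrite (le_trans (ltW z1)).
Qed.

(* Averaging over rotations replaces [ln |z - a|^2] by its mean over the circle
   through [z], which is radial. *)
Lemma disk_log_integral a b : a ^+ 2 + b ^+ 2 != 0 ->
  log_integral mu2 disk (fun z => (z.1 - a) ^+ 2 + (z.2 - b) ^+ 2)
    (pi * disk_mean (a ^+ 2 + b ^+ 2)).
Proof.
move=> ab0; have ab : 0 < a ^+ 2 + b ^+ 2.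
  by rewrite lt_neqAle eq_sym ab0 addr_ge0 ?sqr_ge0.
pose g (z : TR * TR) : R := (z.1 - a) ^+ 2 + (z.2 - b) ^+ 2.
have g0 z : 0 <= g z by rewrite addr_ge0 ?sqr_ge0.
have mg : measurable_fun setT g.
  by apply: measurable_funD; apply: measurable_funX; apply: measurable_funB;
    [exact: measurable_fst|exact: measurable_cst|exact: measurable_snd
    |exact: measurable_cst].
(* On the disk [|z - w|^2 <= 2 (|z|^2 + |w|^2) <= M], by the parallelogram law. *)
pose M := 2 * (1 + (a ^+ 2 + b ^+ 2)).
have M1 : 1 <= M by rewrite /M; lra.
have lnM : 0 <= ln M by exact: ln_ge0.
have lngM z : disk z -> ln (g z) <= ln M.
  move=> /= z1; have := g0 z; rewrite le_eqVlt => /predU1P[<-|gz0].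
    by rewrite ln0.
  rewrite ler_ln ?posrE//; last by apply: lt_le_trans M1.
  rewrite /g /M; have := sqr_ge0 (z.1 + a); have := sqr_ge0 (z.2 + b); nra.
have mdisk : measurable disk by exact: measurable_disk.
pose W := (fun z => (ln M - ln (g z))%:E) \_ disk.
have W0 z : (0 <= W z)%E.
  rewrite /W patchE; case: ifPn => // zD; rewrite lee_fin subr_ge0 lngM//.
  by move: zD; rewrite inE.
have mW : measurable_fun setT W.
  apply/(measurable_restrictT _ mdisk); apply: measurable_funTS.
  apply/measurable_EFinP; apply: measurable_funB; first exact: measurable_cst.
  by apply: measurableT_comp mg; exact: measurable_ln.
pose rot (p : TR * (TR * TR)) : TR * TR :=
  (cos p.1 * p.2.1 - sin p.1 * p.2.2, sin p.1 * p.2.1 + cos p.1 * p.2.2).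
have mrot : measurable_fun setT rot.
  have mc : measurable_fun setT (fun p : TR * (TR * TR) => cos p.1 : R).
    apply: (measurableT_comp _ measurable_fst).
    by apply: continuous_measurable_fun; exact: continuous_cos.
  have ms : measurable_fun setT (fun p : TR * (TR * TR) => sin p.1 : R).
    apply: (measurableT_comp _ measurable_fst).
    by apply: continuous_measurable_fun; exact: continuous_sin.
  have m1 : measurable_fun setT (fun p : TR * (TR * TR) => p.2.1 : R).
    exact: measurableT_comp measurable_fst measurable_snd.
  have m2 : measurable_fun setT (fun p : TR * (TR * TR) => p.2.2 : R).
    exact: measurableT_comp measurable_snd measurable_snd.
  apply: measurable_fun_pair.
    by apply: measurable_funB; exact: measurable_funM.
  by apply: measurable_funD; exact: measurable_funM.
have rot_disk t z : disk (rot (t, z)) <-> disk z.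
  rewrite /rot/=.
  rewrite (_ : _ + _ = (cos t ^+ 2 + sin t ^+ 2) * (z.1 ^+ 2 + z.2 ^+ 2)); last by ring.
  by rewrite cos2Dsin2 mul1r.
(* Integrated over the plane first, [G] gives [2 * pi] times the integral of [W], by rotation
   invariance; integrated over the angle first, it gives the circle means. *)
pose G := (W \o rot) \_ (period `*` setT).
have mPT : measurable (period `*` [set: TR * TR]).
  by apply: measurableX => //; exact: measurable_period.
have mG : measurable_fun setT G.
  apply/(measurable_restrictT _ mPT); apply: measurable_funTS.
  exact: measurableT_comp mW mrot.
have G0 (u : TR * (TR * TR)) : (0 <= G u)%E by rewrite /G patchE; case: ifPn => // _; exact: W0.
have GE t z : G (t, z) = if t \in period then W (rot (t, z)) else 0%E.
  rewrite /G patchE; case: (boolP (t \in period)) => tP.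
    by rewrite mem_set//; split => //=; move: tP; rewrite inE.
  by rewrite memNset// => -[/= tP' _]; move: tP; rewrite mem_set.
have := @fubini_tonelli_prod _ _ _ TR TR TR R mu mu mu G mG G0.
set lhs := (X in X = _ -> _); set rhs := (X in _ = X -> _) => E.
have lhsE : lhs = ((\int[mu2]_z W z) * (2 * pi)%:E)%E.
  rewrite -lebesgue_measure_period -integral_cst; last exact: measurable_period.
  rewrite [RHS]integral_mkcond; apply: eq_integral => t _; rewrite patchE.
  case: (boolP (t \in period)) => tP.
    rewrite -(ge0_integral_rotate (cos2Dsin2 t) mW W0).
    by apply: eq_integral => z _; rewrite GE tP.
  by apply: integral0_eq => z _; rewrite GE (negbTE tP).
have rhsE : rhs = ((2 * pi * (pi * (ln M - disk_mean (a ^+ 2 + b ^+ 2))))%:E)%E.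
  rewrite EFinM -integral_disk_radial// -ge0_integralZl//.
  - rewrite [RHS]integral_mkcond; apply: eq_integral => z _; rewrite patchE.
    transitivity (\int[mu]_(t in period) W (rot (t, z)))%E.
      rewrite [RHS]integral_mkcond; apply: eq_integral => t _.
      by rewrite GE patchE.
    case: (boolP (z \in disk)) => zD; last first.
      apply: integral0_eq => t _; rewrite /W patchE memNset// => /rot_disk.
      by move/mem_set; rewrite (negbTE zD).
    have [_ _ _ ig gE] := circle_log_integral z.1 z.2 ab0.
    transitivity (\int[mu]_(t in period) (ln M - ln (g (rot (t, z))))%:E)%E.
      apply: eq_integral => t _; rewrite /W patchE mem_set//.
      by apply/rot_disk; move: zD; rewrite inE.
    rewrite (integral_cst_sub _ measurable_period lebesgue_measure_period_lty ig) gE.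
    by rewrite [X in fine X]lebesgue_measure_period -EFinM; congr EFin; rewrite /=; ring.
  - apply: measurable_funTS; apply/measurable_EFinP.
    apply: measurable_funB; first exact: measurable_cst.
    apply: measurableT_comp; first exact: measurable_ln.
    apply: measurable_maxr; [exact: measurable_sqr_norm|exact: measurable_cst].
  - move=> z /= z1; rewrite lee_fin subr_ge0 ler_ln ?posrE//.
    + by rewrite ge_max /M; apply/andP; split; lra.
    + by rewrite lt_max ab orbT.
    + exact: lt_le_trans M1.
  - by rewrite lee_fin mulr_ge0 ?pi_ge0.
have pi20 : 2 * pi != 0 :> R by rewrite mulf_neq0// lt0r_neq0 ?pi_gt0.
have IE : (\int[mu2]_(z in disk) (ln M - ln (g z))%:E =
    (pi * (ln M - disk_mean (a ^+ 2 + b ^+ 2)))%:E)%E.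
  rewrite integral_mkcond -/W -[LHS]mule1 -(divff pi20) EFinM muleA -lhsE E rhsE.
  by rewrite -EFinM mulrAC mulfV// mul1r.
have mlng : measurable_fun disk (fun z => ln (g z)).
  by apply: measurable_funTS; apply: measurableT_comp mg; exact: measurable_ln.
have [] := integrable_ub mdisk _ mlng lngM IE.
  by rewrite [X in (X < _)%E]measure_disk1 ltry.
move=> ig; rewrite [X in fine X]measure_disk1/= => gE.
split.
- exact: measurable_funTS.
- by move=> z _; exact: g0.
- exists ([set a] `*` [set b]); split; first exact: measurableX.
    transitivity (mu [set a] * mu [set b])%E; first exact: product_measure1E.
    by rewrite lebesgue_measure_set1 mul0e.
  move=> z [_ /= /eqP]; rewrite paddr_eq0 ?sqr_ge0// !sqrf_eq0 !subr_eq0.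
  by move=> /andP[/eqP ? /eqP].
- exact: ig.
- by rewrite gE; ring.
Qed.

End LogMeans.

(** * Jensen's formula *)

Section Jensen.
Context {R : realType}.
Local Notation mu := (@lebesgue_measure R).
Local Notation TR := (measurableTypeR R).
Local Notation mu2 := (mu \x mu)%E.
Implicit Types (P : {poly R[i]}) (z a : R[i]).

Lemma cabsM z a : cabs (z * a) = cabs z * cabs a.
Proof. exact: ComplexField.Normc.normcM. Qed.

Lemma cabsE (x y : R) : cabs (x +i* y) = Num.sqrt (x ^+ 2 + y ^+ 2).
Proof. by []. Qed.

Lemma cabs_ge0 z : 0 <= cabs z.
Proof. by case: z => x y; rewrite cabsE sqrtr_ge0. Qed.

Lemma cabs_eq0 z : (cabs z == 0) = (z == 0).
Proof.
apply/eqP/eqP => [|->]; first exact: ComplexField.Normc.eq0_normc.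
exact: ComplexField.Normc.normc0.
Qed.

Lemma cabsN z : cabs (- z) = cabs z.
Proof. by case: z => x y; rewrite [LHS]cabsE !sqrrN. Qed.

Lemma cabs_sqr z : cabs z ^+ 2 = complex.Re z ^+ 2 + complex.Im z ^+ 2.
Proof. by case: z => x y; rewrite cabsE sqr_sqrtr// addr_ge0 ?sqr_ge0. Qed.

Lemma cabs_prod (I : Type) (s : seq I) (F : I -> R[i]) :
  cabs (\prod_(i <- s) F i) = \prod_(i <- s) cabs (F i).
Proof.
apply: (big_morph _ cabsM); exact: ComplexField.Normc.normc1.
Qed.

Definition roots P : seq R[i] := sval (closed_field_poly_normal P).

Lemma cabs_horner P z :
  cabs P.[z] = cabs (lead_coef P) * \prod_(a <- roots P) cabs (z - a).
Proof.
rewrite {1}(svalP (closed_field_poly_normal P)) hornerZ horner_prod cabsM cabs_prod.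
by congr (_ * _); apply: eq_bigr => a _; rewrite hornerXsubC.
Qed.

Lemma cabs_lead_coef_gt0 P : P.[0] != 0 -> 0 < cabs (lead_coef P).
Proof.
move=> P0; rewrite lt_neqAle eq_sym cabs_eq0 lead_coef_eq0 cabs_ge0 andbT.
by apply: contraNneq P0 => ->; rewrite horner0.
Qed.

Lemma cabs_root_gt0 P a : P.[0] != 0 -> a \in roots P -> 0 < cabs a.
Proof.
move=> P0 aP; rewrite lt_neqAle cabs_ge0 andbT eq_sym.
move: P0; rewrite -cabs_eq0 cabs_horner; apply: contra => /eqP ca0; apply/eqP.
by rewrite (big_rem a)//= sub0r cabsN ca0 mul0r mulr0.
Qed.

(** By Jensen, each factor [|z - a|] contributes [ln (Num.max 1 (cabs a))]. Since [P.[0] != 0],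
    every root is nonzero, as [circle_log_integral] demands. *)
Lemma log_mahlerE P : P.[0] != 0 ->
  log_mahler P = ln (cabs (lead_coef P)) +
    \sum_(a <- roots P) ln (Num.max 1 (cabs a)).
Proof.
move=> P0; have c0 := cabs_lead_coef_gt0 P0.
have pi20 : 2 * pi != 0 :> R by rewrite mulf_neq0// lt0r_neq0 ?pi_gt0.
have := log_integral_prod measurable_period lebesgue_measure_period_lty c0
  (s := roots P)
  (* The literals 1 and 0 are the coordinates of the point whose rotations trace the unit circle. *)
  (g := fun a t => Num.sqrt ((cos t * 1 - sin t * 0 - complex.Re a) ^+ 2 +
                             (sin t * 1 + cos t * 0 - complex.Im a) ^+ 2))
  (v := fun a => 2 * pi * ln (Num.max (1 ^+ 2 + 0 ^+ 2) (cabs a ^+ 2)) / 2).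
case=> [a aP|_ _ _ _ PE].
  apply: log_integral_sqrt; first exact: measurable_period.
  rewrite cabs_sqr; apply: circle_log_integral.
  by rewrite -cabs_sqr sqrf_eq0 lt0r_neq0// (cabs_root_gt0 P0).
move: PE; rewrite [X in fine X]lebesgue_measure_period/= => PE.
rewrite /log_mahler [X in _ * X](eq_trans _ PE); last first.
  apply: eq_Rintegral => t _; rewrite cabs_horner; congr (ln (_ * _)).
  by apply: eq_bigr => -[a b] _; rewrite !mulr1 !mulr0 subr0 addr0.
rewrite mulrDr mulrCA mulVf// mulr1.
congr (_ + _); rewrite mulr_sumr; apply: eq_bigr => a _.
rewrite expr1n expr0n addr0 -(mulrA (2 * pi)) mulKf//.
have -> : Num.max 1 (cabs a ^+ 2) = Num.max 1 (cabs a) ^+ 2.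
  have a0 := cabs_ge0 a; case: (leP 1 (cabs a)) => h.
    by apply/max_idPr; rewrite exprn_ege1.
  by rewrite expr1n; apply/max_idPl; rewrite expr_le1// ltW.
by rewrite lnXn ?lt_max ?ltr01// -[_ *+ 2]mulr_natr mulfK.
Qed.

Lemma unit_diskE : unit_disk R = [set z | z.1 ^+ 2 + z.2 ^+ 2 < 1].
Proof.
have E (z : R * R) : (cabs (z.1 +i* z.2) < 1) = (z.1 ^+ 2 + z.2 ^+ 2 < 1).
  by rewrite cabsE -[X in _ < X = _]sqrtr1 ltr_sqrt.
by apply/seteqP; split => z; rewrite /unit_disk/= E.
Qed.

Lemma log_areal_mahlerE P : P.[0] != 0 ->
  log_areal_mahler P = ln (cabs (lead_coef P)) +
    \sum_(a <- roots P) disk_mean (cabs a ^+ 2) / 2.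
Proof.
move=> P0; have c0 := cabs_lead_coef_gt0 P0.
pose D : set (TR * TR) := [set z | z.1 ^+ 2 + z.2 ^+ 2 < 1].
have mD : measurable D by exact: measurable_disk.
have muD : mu2 D = pi%:E by exact: measure_disk1.
have Doo : (mu2 D < +oo)%E by rewrite muD ltry.
have := log_integral_prod mD Doo c0 (s := roots P)
  (g := fun (a : R[i]) (z : TR * TR) => Num.sqrt ((z.1 - complex.Re a) ^+ 2 + (z.2 - complex.Im a) ^+ 2))
  (v := fun a => pi * disk_mean (cabs a ^+ 2) / 2).
case=> [a aP|_ _ _ _ PE].
  apply: log_integral_sqrt => //.
  rewrite cabs_sqr; apply: disk_log_integral.
  by rewrite -cabs_sqr sqrf_eq0 lt0r_neq0// (cabs_root_gt0 P0).
move: PE; rewrite [X in fine X]muD/= => PE.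
rewrite /log_areal_mahler unit_diskE [X in _ * X](eq_trans _ PE); last first.
  apply: eq_Rintegral => z _; rewrite cabs_horner; congr (ln (_ * _)).
  by apply: eq_bigr => -[a b] _.
rewrite mulrDr mulrCA mulVf ?lt0r_neq0 ?pi_gt0// mulr1.
congr (_ + _); rewrite mulr_sumr; apply: eq_bigr => a _.
by rewrite !mulrA mulVf ?lt0r_neq0 ?pi_gt0// mul1r.
Qed.

(** Logarithm of the factorization of [P] at 0. *)
Lemma ln_cabs_lead_coef P : cabs P.[0] = 1 ->
  ln (cabs (lead_coef P)) = - \sum_(a <- roots P) ln (cabs a).
Proof.
move=> P1; have P0 : P.[0] != 0 by rewrite -cabs_eq0 P1 oner_eq0.
have : ln (cabs P.[0]) = 0 by rewrite P1 ln1.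
rewrite cabs_horner lnM ?posrE ?cabs_lead_coef_gt0//; last first.
  rewrite big_seq; apply: prodr_gt0 => a aP.
  by rewrite sub0r cabsN (cabs_root_gt0 P0).
have -> : ln (\prod_(a <- roots P) cabs (0 - a)) = \sum_(a <- roots P) ln (cabs a).
  have : {in roots P, forall a, 0 < cabs a} by move=> a; exact: cabs_root_gt0.
  elim: (roots P) => [|a s IH] s0; first by rewrite !big_nil ln1.
  rewrite !big_cons lnM ?posrE.
  - by rewrite IH ?sub0r ?cabsN// => b bs; rewrite s0// in_cons bs orbT.
  - by rewrite sub0r cabsN s0// mem_head.
  - rewrite big_seq; apply: prodr_gt0 => b bs.
    by rewrite sub0r cabsN s0// in_cons bs orbT.
by move=> /eqP; rewrite addr_eq0 => /eqP.
Qed.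

Definition disk_roots P := [seq a <- roots P | cabs a < 1].

(** A root outside the disk contributes [ln (cabs a) - ln (cabs a) = 0]. *)
Lemma log_mahler_disk_roots P : cabs P.[0] = 1 ->
  log_mahler P = \sum_(a <- disk_roots P) - ln (cabs a).
Proof.
move=> P1; have P0 : P.[0] != 0 by rewrite -cabs_eq0 P1 oner_eq0.
rewrite log_mahlerE// ln_cabs_lead_coef// addrC -sumrB big_filter.
rewrite [RHS]big_mkcond; apply: eq_bigr => a _.
by case: ltP => a1; rewrite ?subrr// ln1 sub0r.
Qed.

(** With [u = - ln (cabs a)], a root inside contributes [(cabs a ^+ 2 - 1) / 2 + u], where
    [cabs a ^+ 2 = expR (- (2 * u))]; a root outside contributes 0. *)
Lemma log_areal_mahler_disk_roots P : cabs P.[0] = 1 ->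
  log_areal_mahler P = \sum_(a <- disk_roots P) areal_part (- ln (cabs a)).
Proof.
move=> P1; have P0 : P.[0] != 0 by rewrite -cabs_eq0 P1 oner_eq0.
rewrite log_areal_mahlerE// ln_cabs_lead_coef// addrC -sumrB big_filter.
rewrite [RHS]big_mkcond big_seq [RHS]big_seq; apply: eq_bigr => a aP.
have a0 := cabs_root_gt0 P0 aP.
rewrite /disk_mean expr_lt1 ?(ltW a0)//; case: ifP => a1.
  rewrite /areal_part mulrN opprK mulr_natl -lnXn// lnK ?posrE ?exprn_gt0//.
  by field.
by rewrite lnXn// -[_ *+ 2]mulr_natr mulfK ?subrr.
Qed.

End Jensen.

(** * Summation over the roots in the disk *)

Section Final.
Context {R : realType}.

(** The gap between the two sides is the sum of squared deviations from the mean. *)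
Lemma sqr_sum_le (I : Type) (s : seq I) (u : I -> R) : (0 < size s)%N ->
  (\sum_(i <- s) u i) ^+ 2 / (size s)%:R <= \sum_(i <- s) u i ^+ 2.
Proof.
move=> s0; have n0 : 0 < (size s)%:R :> R by rewrite ltr0n.
have sumE m : \sum_(i <- s) (u i - m) ^+ 2 =
    \sum_(i <- s) u i ^+ 2 - 2 * m * \sum_(i <- s) u i + (size s)%:R * m ^+ 2.
  elim: (s) => [|i r IH]; first by rewrite !big_nil/=; ring.
  by rewrite !big_cons IH/= -natr1; ring.
have := sumE ((\sum_(i <- s) u i) / (size s)%:R).
have : 0 <= \sum_(i <- s) (u i - (\sum_(i <- s) u i) / (size s)%:R) ^+ 2.
  by apply: sumr_ge0 => i _; exact: sqr_ge0.
move=> h E; rewrite E in h; rewrite -subr_ge0; apply: le_trans h _.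
by rewrite le_eqVlt; apply/orP; left; apply/eqP; field; rewrite lt0r_neq0.
Qed.

(** Each [areal_part (u i)] is at most [L], the others being nonnegative, so its series value is
    bounded by the one at [Num.sqrt L]. *)
Lemma sqr_sum_areal_part_le (I : eqType) (s : seq I) (u : I -> R) : (0 < size s)%N ->
  (forall i, i \in s -> 0 <= u i) ->
  let L := \sum_(i <- s) areal_part (u i) in L < 1 ->
  (\sum_(i <- s) u i) ^+ 2 / (size s)%:R <=
  L * (1 + limn (areal_sum (Num.sqrt L))).
Proof.
move=> s0 u0 L L1; apply: le_trans (sqr_sum_le _ s0) _.
rewrite /L mulr_suml -/L big_seq [leRHS]big_seq; apply: ler_sum => i si.
have f0 : 0 <= areal_part (u i) by exact/areal_part_ge0/u0.
have fL : areal_part (u i) <= L.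
  rewrite /L (big_rem i)//= lerDl big_seq; apply: sumr_ge0 => j js.
  by apply/areal_part_ge0/u0; exact: mem_rem js.
pose y := Num.sqrt (areal_part (u i)).
have yE : y ^+ 2 = areal_part (u i) by rewrite sqr_sqrtr.
have sL1 : Num.sqrt L < 1 by rewrite -sqrtr1 ltr_sqrt.
have yL : y <= Num.sqrt L by rewrite ler_wsqrtr.
have y01 : 0 <= y < 1 by rewrite sqrtr_ge0 (le_lt_trans yL).
apply: le_trans (sqr_le_areal_part (u0 i si) y01 yE) _.
apply: le_trans (areal_sum_lim_ge y01) _.
by rewrite yE ler_wpM2l// lerD2l areal_sum_lim_le// sqrtr_ge0.
Qed.

End Final.

Unset Implicit Arguments.

Theorem theorem1p2 (R : realType) (P : {poly R[i]})
    (hP0 : cabs P.[0] = 1)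
    (hareal : areal_mahler P < expR 1)
    (hZ : (1 <= nroots_disk P)%N) :
  let L := ln (areal_mahler P) in
  let S := fun n : nat =>
    \sum_(1 <= k < n) areal_coef R k * L `^ (k%:R / 2) in
  cvgn S /\
  ln (mahler P) ^+ 2 / (nroots_disk P)%:R <= L * (1 + limn S).
Proof.
move=> L S.
have LE : L = \sum_(a <- disk_roots P) areal_part (- ln (cabs a)).
  by rewrite /L expRK log_areal_mahler_disk_roots.
have u0 a : a \in disk_roots P -> 0 <= - ln (cabs a).
  by rewrite mem_filter => /andP[a1 _]; rewrite oppr_ge0 ln_le0// ltW.
have L0 : 0 <= L.
  by rewrite LE big_seq sumr_ge0// => a /u0; exact: areal_part_ge0.
(* The hypothesis on the areal measure gives [Num.sqrt L < 1], where the series converges. *)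
have L1 : L < 1 by move: hareal; rewrite ltr_expR /L expRK.
have SE : S = areal_sum (Num.sqrt L).
  apply/funext => n; apply: eq_bigr => k _; congr (_ * _).
  by rewrite mulrC powRrM powR12_sqrt// powR_mulrn// sqrtr_ge0.
have ZE : nroots_disk P = size (disk_roots P) by rewrite size_filter.
rewrite SE; split.
  by apply: areal_sum_cvg; rewrite sqrtr_ge0 -sqrtr1 ltr_sqrt.
rewrite expRK log_mahler_disk_roots// LE.
have := sqr_sum_areal_part_le (s := disk_roots P) (u := fun a => - ln (cabs a)).
by rewrite ZE /= -LE; apply => //; rewrite -ZE.
Qed.
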